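(* Let $\mathbb{Z}[x,y]$ be the polynomial ring over $\mathbb{Z}$ in two variables, and let $J$ be the ideal of $\mathbb{Z}[x,y]$ generated by $x^n-1$ and $(y-x-1)f_d(x,y)$. Then the Green ring of $\mathcal{C}(n,s,q)$ is isomorphic, as a ring, to the quotient ring $\mathbb{Z}[x,y]/J$.
   Context: Throughout, $k$ is an algebraically closed field of characteristic $0$, $n>1$ is an integer, $\zeta\in k$ is a fixed primitive $n$-th root of unity, $s$ is an integer with $0\le s\le n-1$, $q\in k$ satisfies $q^n=\zeta^s$, and $d$ is the multiplicative order of $q$. For an integer $m$, $m'$ denotes the remainder of $m$ on division by $n$. Let $Z_n$ be the cyclic quiver with vertices $g^i$ ($i\in\mathbb{Z}/n$) and arrows $a_i:g^i\to g^{i+1}$, and let $p_i^l=a_{i+l-1}\cdots a_{i+1}a_i$ be the path of length $l$ starting at $g^i$ (with $p_i^0=g^i$). For $\hbar\in k$ put $m_\hbar=1+\hbar+\cdots+\hbar^{m-1}$, $m!_\hbar=1_\hbar\cdots m_\hbar$, and let $\binom{l+m}{l}_\hbar$ be the Gaussian binomial coefficient $\frac{(l+m)!_\hbar}{l!_\hbar m!_\hbar}$ (the value at $\hbar$ of the corresponding polynomial). $M(n,s,q)$ is the graded coquasi-Hopf algebra with $k$-basis $\{p_i^l: 0\le i\le n-1,\ 0\le l\le d-1\}$, coproduct $\Delta(p_i^l)=\sum_{m=0}^l p_{(i+m)'}^{l-m}\otimes p_i^m$, counit $\varepsilon(p_i^l)=\delta_{l,0}$, and multiplication $$p_i^l\cdot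 p_j^m=\zeta^{-sjl}\,q^{-jl}\,\zeta^{\frac{s(i+l')[m+j-(m+j)']}{n}}\binom{l+m}{l}_{\zeta^{-s}q^{-1}}p_{(i+j)'}^{l+m}$$ (the coefficient vanishes when $l+m\ge d$). The category $\mathcal{C}(n,s,q)$ is the tensor category of finite-dimensional right $M(n,s,q)$-comodules; the coaction on $U\otimes W$ is $u\otimes w\mapsto \sum u_{(0)}\otimes w_{(0)}\otimes u_{(1)}w_{(1)}$. (The multiplication of $M(n,s,q)$ is associative only up to an associator; the associativity constraint affects only identifications of iterated tensor products, which are determined up to isomorphism.) For $0\le i\le n-1$, $0\le e\le d-1$, $V(i,e)$ is the comodule with basis $v_0^i,\dots,v_e^i$ and coaction $\delta(v_m^i)=\sum_{x=m}^e v_x^i\otimes p_{(i+m)'}^{x-m}$. These form a complete list, without repetition, of the indecomposable objects of $\mathcal{C}(n,s,q)$ up to isomorphism. The Green ring of $\mathcal{C}(n,s,q)$ is the ring generated by the isomorphism classes $[M]$ of objects, with relations $[M]+[N]=[M\oplus N]$ and $[M]\cdot[N]=[M\otimes N]$; by Krull-Schmidt it is a free $\mathbb{Z}$-module with basis the classes of the indecomposable objects. Its identity is $[V(0,0)]$. The generalized Fibonacci polynomials $f_i(x,y)\in\mathbb{Z}[x,y]$ are defined by $f_1=1$, $f_2=y$, and $f_i=y f_{i-1}-x f_{i-2}$ for $i>2$. *)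

(* Defs.v *)
From HB Require Import structures.
From mathcomp Require Import all_boot all_order all_algebra.
From mathcomp Require Import boolp.
From mathcomp Require Import mxtens.
From mathcomp Require Import mpoly.
From mathcomp Require Import zify ring.

Set Implicit Arguments.
Unset Strict Implicit.
Unset Printing Implicit Defensive.

Import GRing.Theory.
Local Open Scope ring_scope.

Section LinearExtension.
Variables (k : fieldType) (A B : finType) (T : lmodType k).

Definition lext (F : A -> T) (f : {ffun A -> k^o}) : T :=
  \sum_a (f a : k) *: F a.

Definition blext (F : A -> B -> T) (f : {ffun A -> k^o}) (g : {ffun B -> k^o}) : T :=
  \sum_a \sum_b ((f a : k) * g b) *: F a b.

Lemma lextZ F c f : lext F (c *: f) = c *: lext F f.
Proof.
by rewrite /lext scaler_sumr; apply: eq_bigr => a _; rewrite ffunE scalerA.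
Qed.

Lemma lext_sum F (I : finType) (f : I -> {ffun A -> k^o}) :
  lext F (\sum_i f i) = \sum_i lext F (f i).
Proof.
rewrite /lext exchange_big; apply: eq_bigr => a _ /=.
by rewrite sum_ffunE scaler_suml.
Qed.

Lemma blextZ F c e f g : blext F (c *: f) (e *: g) = (c * e) *: blext F f g.
Proof.
rewrite /blext scaler_sumr; apply: eq_bigr => a _.
rewrite scaler_sumr; apply: eq_bigr => b _.
by rewrite !ffunE scalerA mulrACA.
Qed.

Lemma blext_sum F (I J : finType) (f : I -> {ffun A -> k^o}) (g : J -> {ffun B -> k^o}) :
  blext F (\sum_i f i) (\sum_j g j) = \sum_i \sum_j blext F (f i) (g j).
Proof.
rewrite /blext.
transitivity (\sum_a \sum_b \sum_i \sum_j ((f i a : k) * g j b) *: F a b).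
  apply: eq_bigr => a _; apply: eq_bigr => b _.
  rewrite !sum_ffunE mulr_suml scaler_suml; apply: eq_bigr => i _.
  by rewrite mulr_sumr scaler_suml.
under eq_bigr => a _ do rewrite exchange_big.
rewrite exchange_big /=; apply: eq_bigr => i _.
under eq_bigr => a _ do rewrite exchange_big.
by rewrite exchange_big.
Qed.

End LinearExtension.

Section GaussianBinomials.
Variable k : fieldType.

Definition qnat (m : nat) : {poly k} := \sum_(i < m) 'X^i.

Definition qfact (m : nat) : {poly k} := \prod_(i < m) qnat i.+1.

(* The division is exact, see [qfact_gP]. *)
Definition gauss_poly (N l : nat) : {poly k} :=
  qfact N %/ (qfact l * qfact (N - l)).

Definition gauss (N l : nat) (h : k) : k := (gauss_poly N l).[h].

Fixpoint gP (N l : nat) : {poly k} :=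
  match N, l with
  | _, 0 => 1
  | 0, _.+1 => 0
  | N'.+1, l'.+1 => (gP N' l' + 'X^(l'.+1) * gP N' l'.+1)%R
  end.

Lemma gP0 N : gP N 0 = 1. Proof. by case: N. Qed.

Lemma gPS N l : gP N.+1 l.+1 = gP N l + 'X^(l.+1) * gP N l.+1.
Proof. by []. Qed.

Arguments gP : simpl never.

Lemma gP_small N l : (N < l)%N -> gP N l = 0.
Proof.
elim: N l => [|N IH] [|l] // lt.
by rewrite gPS !IH ?mulr0 ?addr0 //; apply: ltnW.
Qed.

Lemma gPnn N : gP N N = 1.
Proof. by elim: N => // N IH; rewrite gPS IH gP_small // mulr0 addr0. Qed.

Lemma qnatD a b : qnat (a + b) = qnat a + 'X^a * qnat b.
Proof.
rewrite /qnat big_split_ord /= mulr_sumr; congr (_ + _).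
by apply: eq_bigr => i _; rewrite exprD.
Qed.

Lemma qfactS m : qfact m.+1 = qfact m * qnat m.+1.
Proof. by rewrite /qfact big_ord_recr. Qed.

Lemma qnat_neq0 m : qnat m.+1 != 0.
Proof.
apply/eqP => /(congr1 (fun p : {poly k} => p`_0)).
rewrite coef0 /qnat big_ord_recl coefD coef_sum expr0 coef1 /= big1 ?addr0.
  by move/eqP; rewrite oner_eq0.
by move=> i _; rewrite coefXn.
Qed.

Lemma qfact_neq0 m : qfact m != 0.
Proof. by apply/prodf_neq0 => i _; apply: qnat_neq0. Qed.

Lemma qfact_gP l m : qfact (l + m) = gP (l + m) l * (qfact l * qfact m).
Proof.
move: {2}(l + m)%N (erefl (l + m)%N) => N; elim: N l m => [|N IH] l m E.
  have [-> ->] : l = 0%N /\ m = 0%N by lia.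
  by rewrite addn0 gP0 /qfact big_ord0 !mulr1.
case: l E => [|l] E; first by rewrite gP0 /qfact big_ord0 !mul1r.
case: m E => [|m] E; first by rewrite addn0 gPnn /qfact big_ord0 mul1r mulr1.
rewrite addSn gPS mulrDl qfactS.
rewrite {1}(_ : (l + m.+1).+1 = (l.+1 + m.+1)%N) // qnatD mulrDr.
congr (_ + _).
  rewrite IH; last by lia.
  by rewrite (qfactS l) -!mulrA; congr (_ * _); congr (_ * _); rewrite mulrC.
rewrite (_ : (l + m.+1)%N = (l.+1 + m)%N); last by lia.
rewrite IH; last by lia.
by rewrite (qfactS m); ring.
Qed.

Lemma gauss_polyE l m : gauss_poly (l + m) l = gP (l + m) l.
Proof.
by rewrite /gauss_poly qfact_gP addKn mulpK // mulf_neq0 ?qfact_neq0.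
Qed.

Lemma gPS_dual N l : gP N.+1 l.+1 = 'X^(N - l) * gP N l + gP N l.+1.
Proof.
have [lt|le] := ltnP l N; last first.
  have [->|lt] := eqVneq l N; first by rewrite subnn expr0 mul1r !gPnn gP_small // addr0.
  have {le lt}lt : (N < l)%N by rewrite ltn_neqAle eq_sym lt.
  by rewrite !gP_small ?mulr0 ?addr0 //; lia.
pose m := (N - l.+1)%N.
have EN : N = (l.+1 + m)%N by rewrite /m; lia.
have neq0 : qfact l.+1 * qfact m.+1 != 0 by rewrite mulf_neq0 ?qfact_neq0.
apply: (mulIf neq0).
rewrite {1}EN (_ : (l.+1 + m).+1 = (l.+1 + m.+1)%N); last by lia.
rewrite -qfact_gP (_ : (l.+1 + m.+1)%N = (l.+1 + m).+1); last by lia.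
rewrite -EN qfactS.
have -> : N.+1 = (m.+1 + l.+1)%N by lia.
rewrite qnatD (_ : (N - l)%N = m.+1); last by lia.
rewrite mulrDr mulrDl addrC; congr (_ + _).
  rewrite (_ : N = (l + m.+1)%N); last by lia.
  by rewrite {1}qfact_gP (qfactS l); ring.
by rewrite {1}EN qfact_gP -EN (qfactS m); ring.
Qed.

Lemma gP_vdm t u l :
  gP (t + u) l = \sum_(a < l.+1) 'X^((t - a) * (l - a)) * (gP t a * gP u (l - a)).
Proof.
elim: t u l => [|t IH] u l.
  rewrite big_ord_recl /= !subn0 mul0n expr0 gP0 !mul1r big1 ?addr0 // => i _.
  by rewrite gP_small // mul0r mulr0.
rewrite addSnnS IH.
pose F b := 'X^((t - b) * (l - b)) * (gP t b * gP u (l - b.+1)) : {poly k}.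
pose G a := 'X^((t - a).+1 * (l - a)) * (gP t a * gP u (l - a)) : {poly k}.
transitivity (\sum_(a < l) F a + \sum_(a < l.+1) G a).
  rewrite big_ord_recr [X in _ = _ + X]big_ord_recr /= addrA; congr (_ + _).
    rewrite -big_split /=; apply: eq_bigr => a _; rewrite /F /G /=.
    have ltal := ltn_ord a.
    rewrite (_ : (l - a)%N = (l - a.+1).+1); last by lia.
    by rewrite gPS mulSn exprD; ring.
  by rewrite /G /= subnn !muln0 !gP0.
have EG (a : nat) : 'X^((t.+1 - a) * (l - a)) * (gP t a * gP u (l - a)) = G a.
  rewrite /G; have [le|lt] := leqP a t; first by rewrite subSn.
  by rewrite gP_small // !mul0r !mulr0.
rewrite [X in _ + X]big_ord_recl [RHS]big_ord_recl addrCA; congr (_ + _).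
  by rewrite -EG /= !gP0.
rewrite -big_split /=; apply: eq_bigr => a _; rewrite /bump /= !add1n.
rewrite gPS_dual -EG subSS /F.
have ltal := ltn_ord a.
rewrite {1}(_ : (l - a)%N = (l - a.+1).+1); last by lia.
by rewrite mulnS exprD; ring.
Qed.

Lemma gaussE l m h : gauss (l + m) l h = (gP (l + m) l).[h].
Proof. by rewrite /gauss gauss_polyE. Qed.

Lemma gauss_vanish d h l m : d.-primitive_root h ->
  (l < d)%N -> (m < d)%N -> (d <= l + m)%N -> gauss (l + m) l h = 0.
Proof.
move=> hP ld md dlm; rewrite gaussE.
have d1 : (1 < d)%N by lia.
have h1 : h - 1 != 0.
  apply/negP; rewrite subr_eq0 -{1}[h]expr1 -(prim_order_dvd hP).
  by move/dvdn_leq => /(_ isT); lia.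
have qnE i : (h - 1) * (qnat i).[h] = h ^+ i - 1.
  rewrite subrX1; congr (_ * _); rewrite /qnat horner_sum.
  by apply: eq_bigr => j _; rewrite hornerXn.
have nz i : (i < d)%N -> (qfact i).[h] != 0.
  move=> id; rewrite /qfact horner_prod; apply/prodf_neq0 => j _.
  apply: contraTneq (ltn_ord j) => E.
  have /eqP := qnE j.+1; rewrite E mulr0 eq_sym subr_eq0 -(prim_order_dvd hP).
  by move/dvdn_leq => /(_ isT); lia.
have z : (qfact (l + m)).[h] = 0.
  have dm1 : (d.-1 < l + m)%N by lia.
  rewrite /qfact horner_prod (bigD1 (Ordinal dm1)) //=.
  have /eqP := qnE d; rewrite (prim_expr_order hP) subrr mulf_eq0 (negPf h1) /=.
  by rewrite (_ : d.-1.+1 = d) ?prednK //; [move/eqP => ->; rewrite mul0r | lia].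
move: z; rewrite qfact_gP !hornerM => /eqP.
by rewrite !mulf_eq0 (negPf (nz _ ld)) (negPf (nz _ md)) !orbF => /eqP.
Qed.

End GaussianBinomials.

Section CoquasiHopfAlgebra.
Variables (k : fieldType) (n : nat) (zeta : k) (s : nat) (q : k) (d : nat).

(* The basis element p_i^l is indexed by (i, l). *)
Definition M : Type := {ffun 'I_n * 'I_d -> k^o}.
HB.instance Definition _ := GRing.Lmodule.on M.

(* M (x) M, with basis p_i^l (x) p_j^m indexed by ((i, l), (j, m)). *)
Definition M2 : Type := {ffun ('I_n * 'I_d) * ('I_n * 'I_d) -> k^o}.
HB.instance Definition _ := GRing.Lmodule.on M2.

(* The subscript is read modulo n, and the value is 0 when d <= l. *)
Definition p (i l : nat) : M :=
  [ffun b : 'I_n * 'I_d => ((b.1 == (i %% n)%N :> nat) && (b.2 == l :> nat))%:R].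

Definition tens (f g : M) : M2 := [ffun b => (f b.1 : k) * g b.2].

Definition mul_coef (i l j m : nat) : k :=
  zeta ^- (s * j * l)%N * q ^- (j * l)%N
  * zeta ^+ (s * (i + l %% n) * ((m + j - (m + j) %% n) %/ n))%N
  * gauss (l + m) l (zeta ^- s * q^-1).

Definition mulM (f g : M) : M :=
  blext (fun a b : 'I_n * 'I_d =>
           mul_coef a.1 a.2 b.1 b.2 *: p (a.1 + b.1) (a.2 + b.2)) f g.

Definition comulM (f : M) : M2 :=
  lext (fun a : 'I_n * 'I_d =>
          \sum_(m < a.2.+1) tens (p (a.1 + m) (a.2 - m)) (p a.1 m)) f.

Definition counitM (f : M) : k :=
  lext (fun a : 'I_n * 'I_d => (a.2 == 0 :> nat)%:R : k^o) f.

Lemma p_mod i l : p (i %% n) l = p i l.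
Proof. by apply/ffunP => b; rewrite !ffunE modn_mod. Qed.

Lemma p_large i l : (d <= l)%N -> p i l = 0.
Proof.
move=> le; apply/ffunP => b; rewrite !ffunE.
by rewrite (ltn_eqF (leq_trans (ltn_ord b.2) le)) andbF.
Qed.

Lemma pE (f : M) : f = \sum_a (f a : k) *: p a.1 a.2.
Proof.
apply/ffunP => b; rewrite sum_ffunE (bigD1 b) //= !ffunE modn_small //.
rewrite !eqxx /= big1 ?addr0 => [|a nab]; first by rewrite /GRing.scale /= mulr1.
rewrite !ffunE modn_small // (_ : _ && _ = false) ?scaler0 //.
apply: contraNF nab => /andP[/eqP E1 /eqP E2].
by case: a b E1 E2 => a1 a2 [b1 b2] /= /val_inj -> /val_inj ->.
Qed.

Lemma lext_p (T : lmodType k) (F : 'I_n * 'I_d -> T) (i : 'I_n) (l : 'I_d) :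
  lext F (p i l) = F (i, l).
Proof.
rewrite /lext (bigD1 (i, l)) //= !ffunE modn_small // !eqxx scale1r.
rewrite big1 ?addr0 // => -[j m] ne; rewrite ffunE modn_small // (_ : _ && _ = false) ?scale0r //.
apply: contraNF ne => /andP[/= /eqP E1 /eqP E2].
by move: E1 E2 => /val_inj -> /val_inj ->.
Qed.

Lemma tensZ c e f g : tens (c *: f) (e *: g) = (c * e) *: tens f g.
Proof. by apply/ffunP => b; rewrite !ffunE /= -mulrACA. Qed.

Lemma counitMZ c f : counitM (c *: f) = c * counitM f.
Proof. by rewrite /counitM lextZ. Qed.

Lemma counitM_sum (I : finType) (f : I -> M) :
  counitM (\sum_i f i) = \sum_i counitM (f i).
Proof. by rewrite /counitM lext_sum. Qed.

(* A right comodule structure on k^N with standard basis e: the coaction is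
   delta (e_i) = \sum_x e_x (x) coact i x. In terms of coefficients, coassoc and
   counital are (delta (x) id) delta = (id (x) comulM) delta and
   (id (x) counitM) delta = id, evaluated at e_i. *)
Record comodule := Comodule {
  cdim : nat;
  coact : 'M[M]_cdim;
  coassoc : forall i y,
    \sum_x tens (coact x y) (coact i x) = comulM (coact i y);
  counital : forall i x, counitM (coact i x) = (i == x)%:R
}.

(* F is the matrix of the linear map e_i |-> \sum_j F i j e_j. *)
Definition comod_hom (U W : comodule) (F : 'M[k]_(cdim U, cdim W)) : Prop :=
  forall i x, \sum_j F i j *: coact W j x = \sum_y F y x *: coact U i y.

Definition comod_iso (U W : comodule) : Prop :=
  exists F : 'M[k]_(cdim U, cdim W), exists G : 'M[k]_(cdim W, cdim U),
    [/\ comod_hom F, comod_hom G, F *m G = 1%:M & G *m F = 1%:M].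

Section DirectSum.
Variables U W : comodule.

Definition dsum_coact : 'M[M]_(cdim U + cdim W) :=
  block_mx (coact U) 0 0 (coact W).

Lemma tens0l g : tens 0 g = 0.
Proof. by apply/ffunP => b; rewrite !ffunE mul0r. Qed.

Lemma tens0r f : tens f 0 = 0.
Proof. by apply/ffunP => b; rewrite !ffunE mulr0. Qed.

Lemma comulM0 : comulM 0 = 0.
Proof. by rewrite -(scale0r (0 : M)) /comulM lextZ scale0r. Qed.

Lemma counitM0 : counitM 0 = 0.
Proof. by rewrite -(scale0r (0 : M)) counitMZ mul0r. Qed.

Lemma mx0E m1 m2 i x : (0 : 'M[M]_(m1, m2)) i x = 0.
Proof. by rewrite mxE. Qed.

Lemma dsum_coassoc i y :
  \sum_x tens (dsum_coact x y) (dsum_coact i x) = comulM (dsum_coact i y).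
Proof.
rewrite big_split_ord /= /dsum_coact.
case: (split_ordP i) => {}i ->; case: (split_ordP y) => {}y ->.
- under eq_bigr do rewrite !block_mxEul.
  rewrite coassoc block_mxEul big1 ?addr0 // => x _.
  by rewrite block_mxEur mx0E tens0r.
- rewrite block_mxEur mx0E comulM0 !big1 ?addr0 // => x _.
    by rewrite block_mxEur mx0E tens0r.
  by rewrite block_mxEur mx0E tens0l.
- rewrite block_mxEdl mx0E comulM0 !big1 ?addr0 // => x _.
    by rewrite block_mxEdl mx0E tens0l.
  by rewrite block_mxEdl mx0E tens0r.
- under [X in _ + X]eq_bigr do rewrite !block_mxEdr.
  rewrite coassoc block_mxEdr big1 ?add0r // => x _.
  by rewrite block_mxEdl mx0E tens0r.
Qed.

Lemma dsum_counital i x : counitM (dsum_coact i x) = (i == x)%:R.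
Proof.
rewrite /dsum_coact; case: (split_ordP i) => {}i ->; case: (split_ordP x) => {}x ->.
- by rewrite block_mxEul counital eq_lshift.
- by rewrite block_mxEur mx0E counitM0 eq_lrshift.
- by rewrite block_mxEdl mx0E counitM0 eq_rlshift.
- by rewrite block_mxEdr counital eq_rshift.
Qed.

Definition dsum : comodule := Comodule dsum_coassoc dsum_counital.

End DirectSum.

Section Indecomposables.
Variables (i : 'I_n) (e : 'I_d).

Definition V_coact : 'M[M]_e.+1 :=
  \matrix_(m, x) (if (m <= x)%N then p (i + m) (x - m) else 0).

Lemma comulM_p j l : (0 < n)%N -> (l < d)%N ->
  comulM (p j l) = \sum_(m < l.+1) tens (p (j + m) (l - m)) (p j m).
Proof.
move=> n0 ld; rewrite -p_mod.
rewrite /comulM (lext_p _ (Ordinal (ltn_pmod j n0)) (Ordinal ld)) /=.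
apply: eq_bigr => m _; congr tens; last exact: p_mod.
by rewrite -p_mod modnDml p_mod.
Qed.

Lemma counitM_p j l : (0 < n)%N -> (l < d)%N -> counitM (p j l) = (l == 0%N)%:R.
Proof.
move=> n0 ld; rewrite -p_mod.
by rewrite /counitM (lext_p _ (Ordinal (ltn_pmod j n0)) (Ordinal ld)).
Qed.

Lemma V_coassoc m y :
  \sum_x tens (V_coact x y) (V_coact m x) = comulM (V_coact m y).
Proof.
have n0 : (0 < n)%N by apply: leq_ltn_trans (ltn_ord i).
rewrite [in RHS]mxE; have [le|lt] := leqP m y; last first.
  rewrite comulM0 big1 // => x _; rewrite !mxE.
  have [lxy|] := leqP x y; last by rewrite tens0l.
  by rewrite leqNgt (leq_ltn_trans lxy lt) tens0r.
have ye : (y - m < d)%N.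
  by have := ltn_ord e; have := ltn_ord y; lia.
rewrite comulM_p //.
pose F x := tens (if (x <= y)%N then p (i + x) (y - x) else 0)
                 (if (m <= x)%N then p (i + m) (x - m) else 0).
transitivity (\sum_(0 <= x < e.+1) F x).
  by rewrite big_mkord; apply: eq_bigr => x _; rewrite !mxE.
have lye : (y.+1 <= e.+1)%N by apply: ltn_ord.
rewrite (big_cat_nat (n := m)) //=; last by apply: ltnW; apply: ltn_ord.
rewrite big_nat_cond big1 ?add0r; last first.
  by move=> x /andP[/andP[_ lt] _]; rewrite /F (leqNgt m) lt tens0r.
rewrite (big_cat_nat (n := y.+1)) //=; last by lia.
rewrite [X in _ + X]big_nat_cond [X in _ + X]big1 ?addr0; last first.
  by move=> x /andP[/andP[lt _] _]; rewrite /F (leqNgt x y) lt tens0l.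
rewrite -{1}[m : nat]add0n big_addn big_mkord subSn //.
apply: eq_bigr => x _; have := ltn_ord x; rewrite ltnS => lex; rewrite /F.
rewrite (_ : (x + m <= y)%N); last by lia.
rewrite leq_addl addnK; congr tens; congr p; lia.
Qed.

Lemma V_counital m x : counitM (V_coact m x) = (m == x)%:R.
Proof.
have n0 : (0 < n)%N by apply: leq_ltn_trans (ltn_ord i).
rewrite mxE; have [le|lt] := leqP m x; last first.
  by rewrite counitM0 -val_eqE /= gtn_eqF.
rewrite counitM_p //; last by have := ltn_ord e; have := ltn_ord x; lia.
by rewrite -val_eqE /= subn_eq0 eqn_leq le.
Qed.

Definition V : comodule := Comodule V_coassoc V_counital.

End Indecomposables.

Hypothesis zetaP : n.-primitive_root zeta.
Hypothesis qP : q ^+ n = zeta ^+ s.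
Hypothesis dP : d.-primitive_root q.

Local Notation h := (zeta ^- s * q^-1).
Local Notation Z := (zeta ^+ s).

Let n_gt0 : (0 < n)%N := prim_order_gt0 zetaP.
Let d_gt0 : (0 < d)%N := prim_order_gt0 dP.

Lemma Zn1 : Z ^+ n = 1.
Proof. by rewrite exprAC (prim_expr_order zetaP) expr1n. Qed.

Lemma q_neq0 : q != 0.
Proof.
apply/negP => /eqP q0; have := prim_expr_order dP.
by rewrite q0 expr0n gtn_eqF // => /eqP; rewrite eq_sym oner_eq0.
Qed.

Lemma Z_neq0 : Z != 0.
Proof. by rewrite -qP expf_neq0 // q_neq0. Qed.

Lemma hE : h = (q ^+ n.+1)^-1.
Proof. by rewrite exprSr qP invfM. Qed.

Lemma hn : h ^+ n = Z^-1.
Proof. by rewrite exprMn !exprVn Zn1 invr1 mul1r qP. Qed.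

Lemma h_prim : d.-primitive_root h.
Proof.
have dn : (d %| n * n)%N by rewrite (prim_order_dvd dP) exprM qP Zn1.
have co : coprime d n.+1.
  have cn : coprime n n.+1 by apply: coprimenS.
  by apply: coprime_dvdl dn _; rewrite coprimeMl cn.
apply/andP; split=> //; apply/forallP => i; apply/eqP.
rewrite unity_rootE hE exprVn invr_eq1 -exprM -(prim_order_dvd dP).
rewrite Gauss_dvdr //; apply/idP/eqP => [/dvdn_leq|->//].
by move/(_ isT); have := ltn_ord i; lia.
Qed.

Definition mul_scal (i l j m : nat) : k :=
  h ^+ (j * l)%N * Z ^+ ((i + l) * ((m + j) %/ n))%N.

Lemma Zmod c a : Z ^+ ((a %% n) * c)%N = Z ^+ (a * c)%N.
Proof. by rewrite !(mulnC _ c) !exprM expr_mod // exprAC Zn1 expr1n. Qed.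

Lemma hmod a : h ^+ (a %% n) = h ^+ a * Z ^+ (a %/ n).
Proof.
rewrite {2}(divn_eq a n) exprD (mulnC _ n) exprM hn exprVn.
by rewrite mulrAC mulVf ?mul1r // expf_neq0 // Z_neq0.
Qed.

Lemma mul_coefE i l j m :
  mul_coef i l j m = mul_scal i l j m * (gP k (l + m) l).[h].
Proof.
rewrite /mul_coef gaussE; congr (_ * _); rewrite /mul_scal exprMn.
have -> : (m + j - (m + j) %% n = (m + j) %/ n * n)%N.
  by rewrite {1}(divn_eq (m + j) n) addnK.
rewrite mulnK //; congr (_ * _ * _).
- by rewrite exprVn -exprM mulnA.
- by rewrite exprVn.
- by rewrite -mulnA exprM mulnDl exprD Zmod -exprD -mulnDl.
Qed.

Lemma U_split i l j m a b : (a <= l)%N -> (b <= m)%N ->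
  mul_scal ((i + a) %% n) (l - a) ((j + b) %% n) (m - b) * mul_scal i a j b
  = mul_scal i l j m * h ^+ (b * (l - a))%N.
Proof.
move=> al bm; rewrite /mul_scal.
have hmodM x y : h ^+ (x %% n * y)%N = h ^+ (x * y)%N * Z ^+ (x %/ n * y)%N.
  by rewrite exprM hmod exprMn !(exprM h) (exprM Z).
rewrite hmodM (mulnDl ((i + a) %% n)%N) (exprD Z) Zmod -(exprD Z) -mulnDl.
have -> : (i + a + (l - a) = i + l)%N by lia.
have -> : ((m + j) %/ n = (m - b + (j + b) %% n) %/ n + (j + b) %/ n)%N.
  have {1}-> : (m + j = (m - b + (j + b) %% n) + (j + b) %/ n * n)%N.
    by have := divn_eq (j + b) n; lia.
  by rewrite addnC divnMDl // addnC.
set c2 := ((j + b) %/ n)%N; set c1 := ((m - b + _) %/ n)%N; rewrite (addnC b j) -/c2.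
have -> : (j * l = j * a + j * (l - a))%N by rewrite -mulnDr subnKC.
have -> : ((i + l) * (c1 + c2) = (i + l) * c1 + ((i + a) * c2 + c2 * (l - a)))%N.
  by rewrite mulnDr (mulnC c2) -mulnDl; congr (_ + _ * _)%N; lia.
by rewrite (mulnDl j b) !exprD; ring.
Qed.

Definition mulM2 (X Y : M2) : M2 :=
  blext (fun a b : ('I_n * 'I_d) * ('I_n * 'I_d) =>
    tens (mul_coef a.1.1 a.1.2 b.1.1 b.1.2 *: p (a.1.1 + b.1.1) (a.1.2 + b.1.2))
         (mul_coef a.2.1 a.2.2 b.2.1 b.2.2 *: p (a.2.1 + b.2.1) (a.2.2 + b.2.2))) X Y.

Lemma mulM2_tens f g f' g' :
  mulM2 (tens f g) (tens f' g') = tens (mulM f f') (mulM g g').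
Proof.
apply/ffunP => c; rewrite [RHS]ffunE /mulM2 /mulM /blext !sum_ffunE.
rewrite [RHS]big_distrlr /= pair_big /=.
apply: eq_bigr => -[a1 a2] _ /=.
rewrite !sum_ffunE [RHS]big_distrlr /= pair_big /=.
apply: eq_bigr => -[b1 b2] _ /=.
rewrite !ffunE /= /GRing.scale /=; ring.
Qed.

Lemma blext_p (T : lmodType k) (F : 'I_n * 'I_d -> 'I_n * 'I_d -> T)
    (i j : 'I_n) (l m : 'I_d) :
  blext F (p i l) (p j m) = F (i, l) (j, m).
Proof.
rewrite -[RHS](lext_p (fun a => F a (j, m))) /blext /lext.
apply: eq_bigr => a _; rewrite -(lext_p (F a)) /lext scaler_sumr.
by apply: eq_bigr => b _; rewrite scalerA.
Qed.

Lemma mulM_p i l j m : (l < d)%N -> (m < d)%N ->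
  mulM (p i l) (p j m) = mul_coef (i %% n) l (j %% n) m *: p (i + j) (l + m).
Proof.
move=> ld md; rewrite -(p_mod i) -(p_mod j).
rewrite /mulM (blext_p _ (Ordinal (ltn_pmod i n_gt0)) (Ordinal (ltn_pmod j n_gt0))
                  (Ordinal ld) (Ordinal md)) /=.
by rewrite -p_mod modnDml modnDmr p_mod.
Qed.

Lemma mul_coef_large i l j m : (l < d)%N -> (m < d)%N -> (d <= l + m)%N ->
  mul_coef i l j m = 0.
Proof.
by move=> ld md dlm; rewrite /mul_coef (gauss_vanish h_prim ld md dlm) mulr0.
Qed.

Lemma comulM_mul_p i l j m :
    (i < n)%N -> (j < n)%N -> (l < d)%N -> (m < d)%N ->
  comulM (mul_coef i l j m *: p (i + j) (l + m)) =
  mulM2 (\sum_(a < l.+1) tens (p (i + a) (l - a)) (p i a))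
        (\sum_(b < m.+1) tens (p (j + b) (m - b)) (p j b)).
Proof.
move=> iN jN ld md.
pose E t := tens (p (i + j + t) (l + m - t)) (p (i + j) t).
have -> : comulM (mul_coef i l j m *: p (i + j) (l + m)) =
          \sum_(t < (l + m).+1) mul_coef i l j m *: E t.
  rewrite -scaler_sumr; have [lt|le] := ltnP (l + m) d.
    by rewrite /comulM lextZ -/(comulM _) comulM_p.
  by rewrite mul_coef_large // !scale0r comulM0.
pose X a t := mul_scal i l j m * h ^+ ((t - a) * (l - a))%N
              * ((gP k t a).[h] * (gP k (l + m - t) (l - a)).[h]).
transitivity (\sum_(t < (l + m).+1) \sum_(a < l.+1) X a t *: E t).
  apply: eq_bigr => t _; rewrite -scaler_suml; congr (_ *: _).
  have tlm : (t <= l + m)%N by rewrite -ltnS.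
  rewrite mul_coefE -{1}(subnKC tlm) gP_vdm horner_sum mulr_sumr.
  by apply: eq_bigr => a _; rewrite !hornerM hornerXn /X; exact: mulrA.
rewrite exchange_big /mulM2 blext_sum -/mulM2; apply: eq_bigr => a _ /=.
have al : (a <= l)%N by rewrite -ltnS.
transitivity (\sum_(0 <= t < (l + m).+1) X a t *: E t); first by rewrite big_mkord.
rewrite (big_cat_nat (n := a)) //=; last by lia.
rewrite big_nat_cond big1 ?add0r; last first.
  by move=> t /andP[/andP[_ lt] _]; rewrite /X gP_small // horner0 mul0r mulr0 scale0r.
rewrite (big_cat_nat (n := (a + m).+1)) //=; [|lia..].
rewrite [X in _ + X]big_nat_cond [X in _ + X]big1 ?addr0; last first.
  move=> t /andP[/andP[lt1 lt2] _]; rewrite /X (gP_small _ (l := l - a)); last by lia.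
  by rewrite horner0 !mulr0 scale0r.
rewrite -{1}[a : nat]add0n big_addn big_mkord (_ : (_ - _)%N = m.+1); last by lia.
apply: eq_bigr => b _; have bm : (b <= m)%N by rewrite -ltnS.
rewrite -/(mulM2 _ _) mulM2_tens !mulM_p; [|lia..].
rewrite tensZ (modn_small iN) (modn_small jN).
have -> : tens (p (i + a + (j + b)) (l - a + (m - b))) (p (i + j) (a + b)) = E (b + a)%N.
  by rewrite /E; congr tens; congr p; lia.
congr (_ *: _); rewrite !mul_coefE /X addnK [RHS]mulrACA U_split //.
congr (_ * _); rewrite mulrC (addnC b).
by have -> : (l + m - (a + b) = l - a + (m - b))%N by lia.
Qed.

Lemma mulME f g : mulM f g =
  \sum_a \sum_b ((f a : k) * g b) *: (mul_coef a.1 a.2 b.1 b.2 *: p (a.1 + b.1) (a.2 + b.2)).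
Proof. by []. Qed.

Lemma comulM_mul f g : comulM (mulM f g) = mulM2 (comulM f) (comulM g).
Proof.
rewrite [RHS]blext_sum mulME [LHS]lext_sum; apply: eq_bigr => a _.
rewrite lext_sum; apply: eq_bigr => b _.
by rewrite lextZ blextZ -/(mulM2 _ _) -comulM_mul_p.
Qed.

Lemma counitM_mul f g : counitM (mulM f g) = counitM f * counitM g.
Proof.
have E f' : counitM f' = \sum_a (f' a : k) * (a.2 == 0%N :> nat)%:R by [].
rewrite mulME counitM_sum !{}E big_distrlr /=.
apply: eq_bigr => a _; rewrite counitM_sum; apply: eq_bigr => b _.
rewrite !counitMZ [RHS]mulrACA; congr (_ * _).
have [lt|le] := ltnP (a.2 + b.2) d; last first.
  rewrite mul_coef_large // mul0r -natrM mulnb.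
  rewrite (_ : _ && _ = false) //.
  by apply: contraTF le => /andP[/eqP-> /eqP->]; rewrite -ltnNge.
rewrite counitM_p // addn_eq0 -mulnb natrM.
have [a0|_] := eqVneq (a.2 : nat) 0%N; last by rewrite !mul0r mulr0.
have [b0|_] := eqVneq (b.2 : nat) 0%N; last by rewrite !mulr0.
rewrite mul_coefE a0 b0 gP0 hornerC /mul_scal muln0 addn0 add0n divn_small // muln0.
by rewrite !expr0 !mulr1.
Qed.

Section TensorProduct.
Variables U W : comodule.

Definition tensor_coact : 'M[M]_(cdim U * cdim W) :=
  \matrix_(i, x) mulM (coact U (mxtens_unindex i).1 (mxtens_unindex x).1)
                      (coact W (mxtens_unindex i).2 (mxtens_unindex x).2).

Lemma tensor_coassoc i y :
  \sum_x tens (tensor_coact x y) (tensor_coact i x) = comulM (tensor_coact i y).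
Proof.
rewrite [in RHS]mxE comulM_mul -!coassoc [RHS]blext_sum -/mulM2 pair_big /=.
rewrite (reindex (@mxtens_unindex (cdim U) (cdim W))) /=; last first.
  by exists (@mxtens_index _ _) => x _; rewrite (mxtens_indexK, mxtens_unindexK).
by apply: eq_bigr => x _; rewrite -/(mulM2 _ _) mulM2_tens !mxE.
Qed.

Lemma tensor_counital i x : counitM (tensor_coact i x) = (i == x)%:R.
Proof.
rewrite mxE counitM_mul !counital -natrM mulnb; congr (_%:R).
by rewrite -(can_eq (@mxtens_unindexK _ _)).
Qed.

(* e_i (x) e_j is the basis vector of index mxtens_index (i, j). *)
Definition tensor : comodule := Comodule tensor_coassoc tensor_counital.

End TensorProduct.

(* Ring words in the classes of comodules. The comodules on the spaces k^N
   represent all isomorphism classes of finite-dimensional comodules. *)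
Inductive green_word : Type :=
| Cls of comodule
| Gzero
| Gone
| Gopp of green_word
| Gadd of green_word & green_word
| Gmul of green_word & green_word.

(* The congruence generated by the ring axioms and the relations [U] = [W] for
   isomorphic U and W, [U] + [W] = [U (+) W], [U] [W] = [U (x) W] and
   [V(0,0)] = 1. *)
Inductive green_eq : green_word -> green_word -> Prop :=
| Ge_refl a : green_eq a a
| Ge_sym a b : green_eq a b -> green_eq b a
| Ge_trans a b c : green_eq a b -> green_eq b c -> green_eq a c
| Ge_opp a b : green_eq a b -> green_eq (Gopp a) (Gopp b)
| Ge_add a b a' b' :
    green_eq a b -> green_eq a' b' -> green_eq (Gadd a a') (Gadd b b')
| Ge_mul a b a' b' :
    green_eq a b -> green_eq a' b' -> green_eq (Gmul a a') (Gmul b b')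
| Ge_addA a b c : green_eq (Gadd a (Gadd b c)) (Gadd (Gadd a b) c)
| Ge_addC a b : green_eq (Gadd a b) (Gadd b a)
| Ge_add0 a : green_eq (Gadd Gzero a) a
| Ge_addN a : green_eq (Gadd (Gopp a) a) Gzero
| Ge_mulA a b c : green_eq (Gmul a (Gmul b c)) (Gmul (Gmul a b) c)
| Ge_mul1l a : green_eq (Gmul Gone a) a
| Ge_mul1r a : green_eq (Gmul a Gone) a
| Ge_mulDl a b c : green_eq (Gmul (Gadd a b) c) (Gadd (Gmul a c) (Gmul b c))
| Ge_mulDr a b c : green_eq (Gmul a (Gadd b c)) (Gadd (Gmul a b) (Gmul a c))
| Ge_iso U W : comod_iso U W -> green_eq (Cls U) (Cls W)
| Ge_dsum U W : green_eq (Gadd (Cls U) (Cls W)) (Cls (dsum U W))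
| Ge_tensor U W : green_eq (Gmul (Cls U) (Cls W)) (Cls (tensor U W))
| Ge_unit : green_eq (Cls (V (Ordinal n_gt0) (Ordinal d_gt0))) Gone.

Definition green_eqb : rel {classic green_word} := fun a b => `[< green_eq a b >].

Lemma green_equiv : equiv_class_of green_eqb.
Proof.
split=> [a|a b|b a c].
- exact/asboolP/Ge_refl.
- by apply/asboolP/asboolP; apply: Ge_sym.
- by move=> /asboolP ab /asboolP bc; apply/asboolP/(Ge_trans ab).
Qed.

Canonical green_equiv_rel := EquivRelPack green_equiv.

Definition green_ring : Type := {eq_quot green_eqb}%qT.
HB.instance Definition _ := Choice.on green_ring.
HB.instance Definition _ : EqQuotient _ green_eqb green_ring := EqQuotient.on green_ring.

Definition gr (a : green_word) : green_ring := (\pi_green_ring (a : {classic green_word}))%qT.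

Lemma grP a b : green_eq a b <-> gr a = gr b.
Proof.
split=> [ab|/eqmodP/asboolP//].
by apply/eqmodP/asboolP.
Qed.

Lemma gr_repr (x : green_ring) : gr (repr x) = x.
Proof. exact: reprK. Qed.

Lemma repr_gr a : green_eq (repr (gr a)) a.
Proof. by apply/grP; rewrite gr_repr. Qed.

Definition gr_add (x y : green_ring) := gr (Gadd (repr x) (repr y)).
Definition gr_mul (x y : green_ring) := gr (Gmul (repr x) (repr y)).
Definition gr_opp (x : green_ring) := gr (Gopp (repr x)).

Lemma gr_addE a b : gr_add (gr a) (gr b) = gr (Gadd a b).
Proof. by apply/grP/Ge_add; apply: repr_gr. Qed.

Lemma gr_mulE a b : gr_mul (gr a) (gr b) = gr (Gmul a b).
Proof. by apply/grP/Ge_mul; apply: repr_gr. Qed.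

Lemma gr_oppE a : gr_opp (gr a) = gr (Gopp a).
Proof. by apply/grP/Ge_opp; apply: repr_gr. Qed.

Lemma gr_ind (P : green_ring -> Prop) : (forall a, P (gr a)) -> forall x, P x.
Proof. by move=> Pgr x; rewrite -(gr_repr x). Qed.

Lemma gr_addA : associative gr_add.
Proof.
by do 3![elim/gr_ind=> ?]; rewrite !gr_addE; apply/grP/Ge_addA.
Qed.

Lemma gr_addC : commutative gr_add.
Proof. by do 2![elim/gr_ind=> ?]; rewrite !gr_addE; apply/grP/Ge_addC. Qed.

Lemma gr_add0 : left_id (gr Gzero) gr_add.
Proof. by elim/gr_ind=> ?; rewrite !gr_addE; apply/grP/Ge_add0. Qed.

Lemma gr_addN : left_inverse (gr Gzero) gr_opp gr_add.
Proof. by elim/gr_ind=> ?; rewrite gr_oppE gr_addE; apply/grP/Ge_addN. Qed.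

HB.instance Definition _ :=
  GRing.isZmodule.Build green_ring gr_addA gr_addC gr_add0 gr_addN.

Lemma gr_mulA : associative gr_mul.
Proof.
by do 3![elim/gr_ind=> ?]; rewrite !gr_mulE; apply/grP/Ge_mulA.
Qed.

Lemma gr_mul1l : left_id (gr Gone) gr_mul.
Proof. by elim/gr_ind=> ?; rewrite !gr_mulE; apply/grP/Ge_mul1l. Qed.

Lemma gr_mul1r : right_id (gr Gone) gr_mul.
Proof. by elim/gr_ind=> ?; rewrite !gr_mulE; apply/grP/Ge_mul1r. Qed.

Lemma gr_mulDl : left_distributive gr_mul gr_add.
Proof.
by do 3![elim/gr_ind=> ?]; rewrite ?(gr_addE, gr_mulE); apply/grP/Ge_mulDl.
Qed.

Lemma gr_mulDr : right_distributive gr_mul gr_add.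
Proof.
by do 3![elim/gr_ind=> ?]; rewrite ?(gr_addE, gr_mulE); apply/grP/Ge_mulDr.
Qed.

HB.instance Definition _ := GRing.Zmodule_isPzRing.Build green_ring
  gr_mulA gr_mul1l gr_mul1r gr_mulDl gr_mulDr.

End CoquasiHopfAlgebra.

Section QuotientRing.
Variables n d : nat.

Local Notation x := ('X_(0 : 'I_2) : {mpoly int[2]}).
Local Notation y := ('X_(1 : 'I_2) : {mpoly int[2]}).

(* The value at 0 is not part of the definition of the f_i. *)
Fixpoint fib (i : nat) : {mpoly int[2]} :=
  match i with
  | 0 => 0
  | 1 => 1
  | 2 => y
  | (i''.+1 as i').+1 => y * fib i' - x * fib i''
  end.

Definition J : {pred {mpoly int[2]}} := fun f =>
  `[< exists a b, f = a * (x ^+ n - 1) + b * ((y - x - 1) * fib d) >].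

Lemma J_idealr : idealr_closed J.
Proof.
split; rewrite ?unfold_in.
- by apply/asboolP; exists 0, 0; rewrite !mul0r addr0.
- apply/negP => /asboolP[a [b /(congr1 (meval (fun i : 'I_2 => (val i).+1%:R)))]].
  rewrite !(mevalD, mevalB, mevalM, mevalN, meval1, mevalXU) !rmorphXn /= mevalXU /=.
  by rewrite expr1n subrr mulr0 add0r mul0r mulr0 => /eqP.
- move=> c u v; rewrite !unfold_in => /asboolP[a [b ->]] /asboolP[a' [b' ->]].
  by apply/asboolP; exists (c * a + a'), (c * b + b'); ring.
Qed.

HB.instance Definition _ := isIdealr.Build {mpoly int[2]} J J_idealr.

End QuotientRing.

(* Main.v *)
(* A comodule amounts to a representation of the cyclic quiver in which all paths of
   length d vanish: the coefficient of p_i^l in the coaction is the matrix by which the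
   path p_i^l acts. The ranks of these matrices are a complete invariant. Indeed, if l is
   the largest length for which some path p_i^l acts by a nonzero matrix, then a vector
   and a linear form witnessing this split off a direct summand V(i, l), and one concludes
   by induction on the dimension.

   Write x = [V(1,0)] and y = [V(0,1)], where for d = 1 the missing V(0,1) is replaced
   by V(0,0) + V(1,0). Tensoring W on the left with V(1,0) shifts its
   ranks, and V(0,1) (x) W has ranks r(j,l-1) + r(j-1,l+1) for 0 < l < d and
   r(j,0) + r(j-1,0) for l = 0, where r(j,l) are the ranks of W. Hence
   W |-> \sum_j x^j (r(j,0) + \sum_(0 < l < d) r(j,l) (y - x - 1) f_l), with values in
   Z[x,y]/J, is additive, commutes with these two operations, and maps V(i,e) to
   x^i f_(e+1). As V(0,1) (x) V(i,e) and V(i,e+1) + V(i+1,e-1) have the same ranks and the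
   tensor product is associative up to isomorphism, it is multiplicative. This gives the
   ring morphism to Z[x,y]/J; it is bijective because x and y generate the Green ring and
   satisfy there the relations defining J, again by comparison of ranks. *)
Require Import Defs.
From HB Require Import structures.
From mathcomp Require Import all_boot all_order all_algebra.
From mathcomp Require Import boolp mxtens mpoly zify ring.

Set Implicit Arguments.
Unset Strict Implicit.
Unset Printing Implicit Defensive.

Import GRing.Theory.
Local Open Scope ring_scope.

(** * Coefficient matrices of the coaction *)

Section Coefficients.
Variables (k : fieldType) (n d : nat).
Hypotheses (n_gt0 : (0 < n)%N) (d_gt0 : (0 < d)%N).

(* As for [p], the vertex is read modulo n, and the coefficient is 0 when d <= l. *)
Definition pcoef (i l : nat) (f : M k n d) : k :=
  \sum_(b : 'I_n * 'I_d) (f b : k) * ((b.1 == i %% n :> nat)%N && (b.2 == l :> nat))%:R.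

Lemma pcoef_sum i l (I : finType) (P : pred I) (F : I -> M k n d) :
  pcoef i l (\sum_(j | P j) F j) = \sum_(j | P j) pcoef i l (F j).
Proof.
rewrite /pcoef exchange_big /=; apply: eq_bigr => b _.
by rewrite sum_ffunE mulr_suml.
Qed.

Lemma pcoefZ i l c (f : M k n d) : pcoef i l (c *: f) = c * pcoef i l f.
Proof. by rewrite /pcoef mulr_sumr; apply: eq_bigr => b _; rewrite ffunE mulrA. Qed.

Lemma pcoef0 i l : pcoef i l (0 : M k n d) = 0.
Proof. by rewrite -(scale0r (0 : M k n d)) pcoefZ mul0r. Qed.

Lemma pcoef_mod i l (f : M k n d) : pcoef (i %% n) l f = pcoef i l f.
Proof. by rewrite /pcoef modn_mod. Qed.

Lemma pcoef_large i l (f : M k n d) : (d <= l)%N -> pcoef i l f = 0.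
Proof.
move=> dl; apply: big1 => b _.
by rewrite (ltn_eqF (leq_trans (ltn_ord b.2) dl)) andbF mulr0.
Qed.

Lemma pcoefE (f : M k n d) (b : 'I_n * 'I_d) : pcoef b.1 b.2 f = f b.
Proof.
rewrite /pcoef (bigD1 b) //= modn_small // !eqxx mulr1 big1 ?addr0 //.
move=> c ne; rewrite (_ : _ && _ = false) ?mulr0 //.
apply: contraNF ne => /andP[/eqP e1 /eqP e2].
by case: b c e1 e2 => b1 b2 [c1 c2] /= /val_inj -> /val_inj ->.
Qed.

Lemma pcoefP (f g : M k n d) :
  (forall i l, (i < n)%N -> (l < d)%N -> pcoef i l f = pcoef i l g) -> f = g.
Proof. by move=> eq_fg; apply/ffunP => b; rewrite -!pcoefE eq_fg. Qed.

Lemma pcoef_p i l j m : (l < d)%N ->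
  pcoef i l (p k n d j m) = ((j == i %[mod n]) && (m == l))%:R.
Proof.
move=> ld; rewrite -pcoef_mod.
have -> : pcoef (i %% n) l (p k n d j m)
  = p k n d j m (Ordinal (ltn_pmod i n_gt0), Ordinal ld) by rewrite -pcoefE.
by rewrite ffunE /= (eq_sym (i %% n)%N) (eq_sym l).
Qed.

Lemma M_expand (f : M k n d) :
  f = \sum_(b : 'I_n * 'I_d) pcoef b.1 b.2 f *: p k n d b.1 b.2.
Proof. by rewrite [LHS]pE; apply: eq_bigr => b _; rewrite pcoefE. Qed.

(** A path contributes to the tensor of paths (b, c) only when it is cut after its first [c.2]
    arrows: [c] is then its initial segment, and [b] continues from the vertex [c.1 + c.2]. *)
Lemma comulM_coef (f : M k n d) (b c : 'I_n * 'I_d) :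
  comulM f (b, c) = (b.1 == c.1 + c.2 %[mod n])%:R * pcoef c.1 (c.2 + b.2) f.
Proof.
rewrite /comulM /lext sum_ffunE [in RHS]/pcoef mulr_sumr; apply: eq_bigr => a _.
rewrite ffunE /= sum_ffunE [LHS]/GRing.scale /= mulrCA; congr (_ * _).
have [c2a|ac2] := leqP c.2 a.2; last first.
  rewrite big1 => [|m _]; last first.
    rewrite !ffunE /= (_ : (c.2 == m :> nat) = false) ?andbF ?mulr0 //.
    by rewrite gtn_eqF // (leq_trans (ltn_ord m)).
  by rewrite (ltn_eqF (ltn_addr _ ac2)) andbF mulr0.
have c2a' : (c.2 < a.2.+1)%N by [].
rewrite (bigD1 (Ordinal c2a')) //= big1 ?addr0 => [|m ne]; last first.
  rewrite !ffunE /= (_ : (c.2 == m :> nat) = false) ?andbF ?mulr0 //.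
  by apply: contraNF ne => /eqP e; apply/eqP/val_inj.
rewrite !ffunE /= eqxx andbT -!natrM !mulnb; congr (nat_of_bool _)%:R.
rewrite (modn_small (ltn_ord a.1)) (modn_small (ltn_ord c.1)).
rewrite (modn_small (ltn_ord b.1)) (eq_sym (c.1 : nat)).
have [->|] := eqVneq (a.1 : nat) (c.1 : nat); last by rewrite !andbF.
rewrite andbT andTb; congr (_ && _).
by rewrite -(eqn_add2l c.2) subnKC // eq_sym.
Qed.

Lemma tensE (f g : M k n d) (b c : 'I_n * 'I_d) :
  tens f g (b, c) = pcoef b.1 b.2 f * pcoef c.1 c.2 g.
Proof. by rewrite ffunE !pcoefE. Qed.

Lemma counitM_coef (f : M k n d) : counitM f = \sum_(i < n) pcoef i 0 f.
Proof.
rewrite {1}(M_expand f) counitM_sum.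
transitivity (\sum_(i : 'I_n) \sum_(l : 'I_d) pcoef i l f * (l == 0 :> nat)%:R).
  rewrite [RHS]pair_big; apply: eq_bigr => -[i l] _ /=.
  by rewrite counitMZ counitM_p.
apply: eq_bigr => i _.
rewrite (bigD1 (Ordinal d_gt0)) //= mulr1 big1 ?addr0 // => l ne.
rewrite (_ : (l == 0 :> nat) = false) ?mulr0 //.
by apply: contraNF ne => /eqP e; apply/eqP/val_inj.
Qed.

(** * Comodule axioms as relations between coefficient matrices *)

Section Matrices.
Variables (N : nat).
Implicit Type A : 'M[M k n d]_N.

Definition cfmx A (i l : nat) : 'M[k]_N := \matrix_(a, b) pcoef i l (A a b).

(** Comparing the coefficients of p_j^m (x) p_i^l turns coassociativity into the multiplication
    table of the path algebra. Vectors are rows, so products are read from left to right: first the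
    path from [i], then the one from [j]. *)
Lemma coassoc_cfmx A :
  (forall i y, \sum_x tens (A x y) (A i x) = comulM (A i y)) <->
  (forall i l j m, (i < n)%N -> (l < d)%N -> (j < n)%N -> (m < d)%N ->
     cfmx A i l *m cfmx A j m = (j == i + l %[mod n])%:R *: cfmx A i (l + m)).
Proof.
split=> [H i l j m i_n l_d j_n m_d|H i y].
  apply/matrixP => a b; rewrite !mxE.
  pose c1 : 'I_n * 'I_d := (Ordinal j_n, Ordinal m_d).
  pose c2 : 'I_n * 'I_d := (Ordinal i_n, Ordinal l_d).
  have /ffunP/(_ (c1, c2)) := H a b.
  rewrite comulM_coef /= => <-; rewrite sum_ffunE; apply: eq_bigr => x _.
  by rewrite !mxE tensE mulrC.
apply/ffunP => -[b c]; rewrite sum_ffunE comulM_coef.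
have /matrixP/(_ i y) := H c.1 c.2 b.1 b.2 (ltn_ord _) (ltn_ord _) (ltn_ord _) (ltn_ord _).
rewrite !mxE => <-; apply: eq_bigr => x _.
by rewrite !mxE tensE mulrC.
Qed.

Lemma counital_cfmx A :
  (forall i x, counitM (A i x) = (i == x)%:R) <->
  \sum_(i < n) cfmx A i 0 = 1%:M.
Proof.
split=> [H|/matrixP H a b].
  apply/matrixP => a b; rewrite summxE !mxE -H counitM_coef.
  by apply: eq_bigr => i _; rewrite mxE.
have := H a b; rewrite summxE !mxE => <-; rewrite counitM_coef.
by apply: eq_bigr => i _; rewrite mxE.
Qed.

Lemma cfmx_mod A i l : cfmx A (i %% n) l = cfmx A i l.
Proof. by apply/matrixP => a b; rewrite !mxE pcoef_mod. Qed.

Lemma cfmx_large A i l : (d <= l)%N -> cfmx A i l = 0.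
Proof. by move=> dl; apply/matrixP => a b; rewrite !mxE pcoef_large. Qed.

End Matrices.

(** * Coefficient matrices and ranks of comodules *)

Section Comodules.
Implicit Types U W : comodule k n d.

Definition cf U := cfmx (coact U).

Lemma cf_modn U i l : cf U (i %% n) l = cf U i l.
Proof. exact: cfmx_mod. Qed.

Lemma cf_eqmod U i j l : i = j %[mod n] -> cf U i l = cf U j l.
Proof. by move=> e; rewrite -cf_modn e cf_modn. Qed.

Lemma cf_large U i l : (d <= l)%N -> cf U i l = 0.
Proof. exact: cfmx_large. Qed.

Lemma cf_mul U i l j m :
  cf U i l *m cf U j m = (j == i + l %[mod n])%:R *: cf U i (l + m).
Proof.
have [ld|dl] := ltnP l d; last first.
  by rewrite [cf U i l]cf_large // mul0mx cf_large ?scaler0 // (leq_trans dl) // leq_addr.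
have [md|dm] := ltnP m d; last first.
  by rewrite [cf U j m]cf_large // mulmx0 cf_large ?scaler0 // (leq_trans dm) // leq_addl.
have /coassoc_cfmx H := @coassoc _ _ _ U.
have := H (i %% n)%N l (j %% n)%N m.
by rewrite !ltn_pmod // /cf !cfmx_mod modn_mod modnDml; apply.
Qed.

Lemma cf_mulS U i l m : cf U i l *m cf U (i + l) m = cf U i (l + m).
Proof. by rewrite cf_mul eqxx scale1r. Qed.

Lemma cf_sum1 U : \sum_(i < n) cf U i 0 = 1%:M.
Proof. exact/counital_cfmx/counital. Qed.

Lemma comod_homP U W (F : 'M[k]_(cdim U, cdim W)) :
  comod_hom F <->
  (forall i l, (i < n)%N -> (l < d)%N -> F *m cf W i l = cf U i l *m F).
Proof.
split=> [H i l i_n l_d|H a x].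
  apply/matrixP => a x; rewrite !mxE.
  have := congr1 (pcoef i l) (H a x); rewrite !pcoef_sum.
  under eq_bigr do rewrite pcoefZ.
  under [in RHS]eq_bigr do rewrite pcoefZ mulrC.
  move=> E; under eq_bigr do rewrite mxE.
  by under [in RHS]eq_bigr do rewrite mxE.
apply: pcoefP => i l i_n l_d; rewrite !pcoef_sum.
have /matrixP/(_ a x) := H i l i_n l_d; rewrite !mxE.
under eq_bigr do rewrite mxE.
under [in RHS]eq_bigr do rewrite mxE.
under [in X in _ -> X]eq_bigr do rewrite pcoefZ.
by under [in X in _ -> _ = X]eq_bigr do rewrite pcoefZ mulrC.
Qed.

(** The inverse of a bijective comodule map is a comodule map, so one intertwining condition
    suffices. *)
Lemma comod_isoP U W (F : 'M[k]_(cdim U, cdim W)) (G : 'M[k]_(cdim W, cdim U)) :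
  (forall i l, (i < n)%N -> (l < d)%N -> F *m cf W i l = cf U i l *m F) ->
  F *m G = 1%:M -> G *m F = 1%:M -> comod_iso U W.
Proof.
move=> H FG GF; exists F, G; split=> //; apply/comod_homP => // i l i_n l_d.
by rewrite -[LHS]mulmx1 -FG mulmxA -(mulmxA G) -H // mulmxA GF mul1mx.
Qed.

Definition rk U i l := \rank (cf U i l).

Lemma rk_modn U i l : rk U (i %% n) l = rk U i l.
Proof. by rewrite /rk cf_modn. Qed.

Lemma rk_large U i l : (d <= l)%N -> rk U i l = 0%N.
Proof. by move=> dl; rewrite /rk cf_large ?mxrank0. Qed.

Lemma rk_iso U W i l : comod_iso U W -> rk U i l = rk W i l.
Proof.
case=> F [G [/comod_homP hF /comod_homP hG FG GF]].
have [ld|dl] := ltnP l d; last by rewrite !rk_large.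
rewrite -rk_modn -(rk_modn W); set j := (i %% n)%N.
have jn : (j < n)%N by rewrite ltn_pmod.
apply/eqP; rewrite eqn_leq; apply/andP; split; rewrite /rk.
  rewrite -[X in (\rank X <= _)%N]mulmx1 -FG mulmxA -hF // -mulmxA.
  by apply: leq_trans (mxrankM_maxr _ _) (mxrankM_maxl _ _).
rewrite -[X in (\rank X <= _)%N]mulmx1 -GF mulmxA -hG // -mulmxA.
by apply: leq_trans (mxrankM_maxr _ _) (mxrankM_maxl _ _).
Qed.

Lemma cf_dsum U W i l :
  cf (dsum U W) i l = block_mx (cf U i l) 0 0 (cf W i l).
Proof.
apply/matrixP => a b; rewrite [LHS]mxE /= /dsum_coact.
case: (split_ordP a) => {}a ->; case: (split_ordP b) => {}b ->;
  by rewrite ?(block_mxEul, block_mxEur, block_mxEdl, block_mxEdr) !mxE ?pcoef0.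
Qed.

Lemma rk_dsum U W i l : rk (dsum U W) i l = (rk U i l + rk W i l)%N.
Proof. by rewrite /rk cf_dsum rank_diag_block_mx. Qed.

End Comodules.
End Coefficients.

(** * Strings *)

(** The matrix factors as [B *m C] through dimension [#|P|], where the transposes of [B] and [C] are
    a left and a right inverse. This bounds the rank from both sides. *)
Lemma rank_partial_perm (k : fieldType) (N : nat) (P : pred 'I_N) (f : 'I_N -> 'I_N)
    (A : 'M[k]_N) :
  {in P &, injective f} -> (forall a b, A a b = (P a && (b == f a))%:R) ->
  \rank A = #|P|.
Proof.
move=> f_inj AE.
pose e (i : 'I_#|P|) : 'I_N := enum_val i.
have eP i : P (e i) by exact: (enum_valP i).
pose B : 'M[k]_(N, #|P|) := \matrix_(a, i) (a == e i)%:R.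
pose C : 'M[k]_(#|P|, N) := \matrix_(i, b) (b == f (e i))%:R.
have A_BC : A = B *m C.
  apply/matrixP => a b; rewrite AE mxE; case Pa : (P a) => /=; last first.
    rewrite big1 // => i _; rewrite !mxE; case: eqP => [ai|]; last by rewrite mul0r.
    by rewrite ai eP in Pa.
  pose i0 := enum_rank_in (Pa : a \in P) a.
  have i0E : e i0 = a by exact: enum_rankK_in.
  rewrite (bigD1 i0) //= !mxE i0E eqxx mul1r big1 ?addr0 // => i ne.
  rewrite !mxE; case: eqP => [ai|]; last by rewrite mul0r.
  by case/negP: ne; apply/eqP/enum_val_inj; rewrite -[enum_val i]/(e i) -ai -i0E.
have BB : B^T *m B = 1%:M.
  apply/matrixP => i j; rewrite !mxE (bigD1 (e i)) //= !mxE eqxx mul1r.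
  rewrite big1 ?addr0 => [|a ne]; last by rewrite !mxE (negPf ne) mul0r.
  by rewrite (inj_eq enum_val_inj).
have CC : C *m C^T = 1%:M.
  apply/matrixP => i j; rewrite !mxE (bigD1 (f (e i))) //= !mxE eqxx mul1r.
  rewrite big1 ?addr0 => [|a ne]; last by rewrite !mxE (negPf ne) mul0r.
  by rewrite (inj_in_eq f_inj) ?(inj_eq enum_val_inj) //; exact: eP.
apply/eqP; rewrite eqn_leq A_BC; apply/andP; split.
  by apply: leq_trans (mxrankM_maxr _ _) (rank_leq_row _).
have r1 : \rank (B^T *m (B *m C) *m C^T) = #|P|.
  by rewrite mulmxA BB mul1mx CC mxrank1.
by rewrite -[leqLHS]r1; apply: leq_trans (mxrankM_maxl _ _) (mxrankM_maxr _ _).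
Qed.

Section Strings.
Variables (k : fieldType) (n d : nat).
Hypotheses (n_gt0 : (0 < n)%N) (d_gt0 : (0 < d)%N).

(* The case d = 1, where [p i l = 0] for l > 0, is included so that the
   two-dimensional string exists for every d. *)
Definition string_len t := (t <= d)%N || (d == 1)%N.

Section String.
Variables (i t : nat).

Definition string_coact : 'M[M k n d]_t :=
  \matrix_(a, b) (if (a <= b)%N then p k n d (i + a) (b - a) else 0).

Lemma cfmx_string j l a b : (l < d)%N ->
  cfmx string_coact j l a b = ((b == a + l :> nat)%N && (i + a == j %[mod n])%N)%:R.
Proof.
move=> ld; rewrite !mxE; have [ab|ba] := leqP a b; last first.
  by rewrite pcoef0 (ltn_eqF (ltn_addr l ba)).
rewrite pcoef_p // andbC; congr (nat_of_bool (_ && _))%:R.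
by rewrite -(eqn_add2l a) subnKC.
Qed.

Hypothesis t_ok : string_len t.

Lemma string_coassoc a b :
  \sum_x tens (string_coact x b) (string_coact a x) = comulM (string_coact a b).
Proof.
move: a b; apply/coassoc_cfmx => // j l j' m jn ld jn' md.
apply/matrixP => a b; rewrite mxE [RHS]mxE.
under eq_bigr do rewrite !cfmx_string //.
have [lmd|dlm] := ltnP (l + m) d; last first.
  rewrite cfmx_large // mxE mulr0 big1 // => x _.
  rewrite -natrM mulnb; case: eqP => //= xE; case: eqP => //= _; case: eqP => //= bE.
  (* A path of length l + m >= d inside the string forces t > d, hence d = 1; but then l = m = 0,
     against d <= l + m. *)
  move: t_ok; rewrite /string_len => /orP t_ok'.
  by have := ltn_ord b; rewrite bE xE => bt; exfalso; case: t_ok' => [|/eqP]; lia.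
rewrite cfmx_string //.
have [bE|ne] := eqVneq (b : nat) (a + (l + m))%N; last first.
  rewrite mulr0 big1 // => x _; rewrite -natrM mulnb.
  case: eqP => //= xE; rewrite xE (_ : (b == a + l + m :> nat)%N = false) ?andbF //.
  by apply: contraNF ne => /eqP ->; rewrite addnA.
have alt : (a + l < t)%N by have := ltn_ord b; rewrite bE; lia.
rewrite (bigD1 (Ordinal alt)) //= eqxx big1 ?addr0 => [|x ne]; last first.
  rewrite (_ : (x == a + l :> nat)%N = false) ?mul0r //.
  by apply: contraNF ne => /eqP xE; apply/eqP/val_inj.
rewrite -!natrM !mulnb /= bE addnA eqxx /= andbC; congr (nat_of_bool _)%:R.
have [aj|_] := eqVneq ((i + a) %% n)%N (j %% n)%N; last by rewrite !andbF.
by rewrite !andbT addnA -modnDml aj modnDml eq_sym.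
Qed.

Lemma string_counital a b : counitM (string_coact a b) = (a == b)%:R.
Proof.
move: a b; apply/counital_cfmx => //.
apply/matrixP => a b; rewrite summxE mxE.
under eq_bigr do rewrite cfmx_string // addn0.
rewrite (bigD1 (Ordinal (ltn_pmod (i + a) n_gt0))) //= modn_mod eqxx andbT.
rewrite big1 ?addr0 => [|x ne]; first by rewrite eq_sym.
rewrite (_ : (_ == _ %[mod n])%N = false) ?andbF //.
apply: contraNF ne => /eqP xE; apply/eqP/val_inj; rewrite /= xE.
by rewrite modn_small.
Qed.

Definition string : comodule k n d := Comodule string_coassoc string_counital.

Lemma cf_string j l a b : (l < d)%N ->
  cf string j l a b = ((b == a + l :> nat)%N && (i + a == j %[mod n])%N)%:R.
Proof. exact: cfmx_string. Qed.

(** The path of length [l] from [j] sends the basis vector [a] to [a + l] if [a] lies over [j] and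
    [a + l] is still inside the string, so the rank counts these [a]. *)
Lemma rk_string j l : (l < d)%N ->
  rk string j l = (\sum_(a < t - l) (i + a == j %[mod n])%N)%N.
Proof.
(* [insubd] falls back to [a] itself when [a + l] leaves the string; the corresponding row of the
   matrix is zero. *)
move=> ld; pose f (a : 'I_t) := insubd a (a + l)%N.
pose P : pred 'I_t := [pred a : 'I_t | (a + l < t)%N && (i + a == j %[mod n])%N].
rewrite /rk (rank_partial_perm (P := P) (f := f)) => [|a b|a b].
- rewrite -sum1_card big_mkcond /=.
  pose F a := if (a + l < t)%N && (i + a == j %[mod n])%N then 1%N else 0%N.
  rewrite -(big_mkord xpredT F) (big_cat_nat (n := t - l)) ?leq_subr //=.
  rewrite [X in (_ + X)%N]big_nat_cond [X in (_ + X)%N]big1 ?addn0; last first.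
    move=> a /andP[/andP[le lt] _]; rewrite /F (_ : (a + l < t)%N = false) //.
    by apply/negbTE; rewrite -leqNgt; lia.
  rewrite big_mkord; apply: eq_bigr => a _; rewrite /F.
  rewrite (_ : (a + l < t)%N = true); last by have := ltn_ord a; lia.
  by case: eqP.
- rewrite !inE => /andP[a_lt _] /andP[b_lt _] /(congr1 val).
  by rewrite !val_insubd a_lt b_lt => /addIn/val_inj.
- rewrite cf_string // /P /= -!andbA; congr (nat_of_bool _)%:R.
  have [alt|tal] := ltnP (a + l) t; last first.
    by rewrite (_ : (_ == _ :> nat) = false) //; have := ltn_ord b; case: eqP; lia.
  by rewrite andbC -val_eqE val_insubd alt.
Qed.

End String.

Lemma string_V (i : 'I_n) (e : 'I_d) (ok : string_len e.+1) :
  comod_iso (string i ok) (V k i e).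
Proof.
apply: (@comod_isoP _ _ _ (string i ok) (V k i e) (1%:M : 'M[k]_e.+1) (1%:M : 'M[k]_e.+1)).
- by move=> j l _ _; rewrite mul1mx mulmx1.
- by rewrite mulmx1.
- by rewrite mulmx1.
Qed.

End Strings.

(** * Splitting off direct summands *)

(** In a rank factorization Q = C R the factor C has a left inverse and R a right inverse;
    cancelling them in C R C R = C R leaves R C = 1. *)
Lemma idempotent_factor (k : fieldType) (N : nat) (Q : 'M[k]_N) : Q *m Q = Q ->
  exists r (R : 'M_(r, N)) (C : 'M_(N, r)), C *m R = Q /\ R *m C = 1%:M.
Proof.
move=> QQ; exists (\rank Q), (row_base Q), (col_base Q).
have [R' RR'] := row_freeP (row_base_free Q).
have [C' CC'] := row_fullP (col_base_full Q).
have CRQ : col_base Q *m row_base Q = Q := mulmx_base Q.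
split=> //; move: (row_base Q) (col_base Q) RR' CC' CRQ => R C RR' CC' CRQ.
have -> : R *m C = C' *m (C *m R *m (C *m R)) *m R'.
  by rewrite !mulmxA CC' mul1mx -!mulmxA RR' mulmx1.
have -> : C *m R *m (C *m R) = C *m R by rewrite CRQ.
by rewrite mulmxA CC' mul1mx RR'.
Qed.

Section Splitting.
Variables (k : fieldType) (n d : nat).
Hypotheses (n_gt0 : (0 < n)%N) (d_gt0 : (0 < d)%N).
Implicit Types U W S : comodule k n d.

Section Retract.
Variables (U : comodule k n d) (N : nat).
Variables (R : 'M[k]_(N, cdim U)) (C : 'M[k]_(cdim U, N)).

(** The compression of [U] to the image of [C *m R], prescribed by its coefficient matrices. It is a
    comodule when [C *m R] is an idempotent comodule endomorphism. *)
Definition retract_coact : 'M[M k n d]_N :=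
  \matrix_(a, b) \sum_(c : 'I_n * 'I_d)
    (R *m cf U c.1 c.2 *m C) a b *: p k n d c.1 c.2.

Lemma cfmx_retract i l : (i < n)%N -> (l < d)%N ->
  cfmx retract_coact i l = R *m cf U i l *m C.
Proof.
move=> i_n ld; apply/matrixP => a b; rewrite mxE mxE pcoef_sum.
rewrite (bigD1 (Ordinal i_n, Ordinal ld)) //= pcoefZ pcoef_p // !eqxx mulr1.
rewrite big1 ?addr0 // => c ne; rewrite pcoefZ pcoef_p //.
rewrite (_ : _ && _ = false) ?mulr0 //.
apply: contraNF ne => /andP[]; rewrite !modn_small // => /eqP e1 /eqP e2.
by apply/eqP; case: c e1 e2 => c1 c2 /= e1 e2; congr (_, _); apply/val_inj.
Qed.

Hypothesis RC : R *m C = 1%:M.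
Hypothesis CR : forall i l, C *m R *m cf U i l = cf U i l *m (C *m R).

Lemma retract_coassoc a b :
  \sum_x tens (retract_coact x b) (retract_coact a x) = comulM (retract_coact a b).
Proof.
move: a b; apply/coassoc_cfmx => // i l j m i_n l_d j_n m_d.
rewrite (cfmx_retract i_n l_d) (cfmx_retract j_n m_d).
have -> : R *m cf U i l *m C *m (R *m cf U j m *m C)
  = R *m (cf U i l *m (C *m R)) *m cf U j m *m C by rewrite !mulmxA.
rewrite -CR !mulmxA RC mul1mx -[X in X *m C]mulmxA cf_mul //.
rewrite -scalemxAr -scalemxAl; congr (_ *: _).
have [lmd|dlm] := ltnP (l + m) d; first by rewrite cfmx_retract.
by rewrite cfmx_large // cf_large // mulmx0 mul0mx.
Qed.

Lemma retract_counital a b : counitM (retract_coact a b) = (a == b)%:R.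
Proof.
move: a b; apply/counital_cfmx => //.
under eq_bigr do rewrite cfmx_retract //.
by rewrite -mulmx_suml -mulmx_sumr cf_sum1 // mulmx1.
Qed.

Definition retract : comodule k n d := Comodule retract_coassoc retract_counital.

End Retract.

Lemma comod_iso_dim U W : comod_iso U W -> cdim U = cdim W.
Proof.
case=> F [G [_ _ FG GF]]; apply/eqP; rewrite eqn_leq; apply/andP; split.
  by rewrite -(mxrank1 k (cdim U)) -FG (leq_trans (mxrankM_maxr _ _)) ?rank_leq_row.
by rewrite -(mxrank1 k (cdim W)) -GF (leq_trans (mxrankM_maxr _ _)) ?rank_leq_row.
Qed.

(** The invertible composite S -> U -> S makes [S] a retract of [U], and the complement [K] is the
    image of the complementary idempotent. *)
Lemma split_off U S (I : 'M[k]_(cdim S, cdim U)) (P : 'M[k]_(cdim U, cdim S)) :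
  (forall j l, (j < n)%N -> (l < d)%N -> I *m cf U j l = cf S j l *m I) ->
  (forall j l, (j < n)%N -> (l < d)%N -> P *m cf S j l = cf U j l *m P) ->
  I *m P \in unitmx ->
  exists2 K, comod_iso U (dsum S K) & (cdim U = cdim S + cdim K)%N.
Proof.
move=> hI hP0 uIP.
(* Dividing by the comodule automorphism [I *m P] of [S] yields a comodule map that is a retraction
   of [I]. *)
pose Pn := P *m invmx (I *m P).
have hIP j l : (j < n)%N -> (l < d)%N -> I *m P *m cf S j l = cf S j l *m (I *m P).
  by move=> jn ld; rewrite -mulmxA hP0 // !mulmxA hI.
have hP j l : (j < n)%N -> (l < d)%N -> Pn *m cf S j l = cf U j l *m Pn.
  move=> jn ld; rewrite /Pn [RHS]mulmxA -hP0 // -!mulmxA; congr (_ *m _).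
  apply: (can_inj (mulKmx uIP)); rewrite !mulmxA mulmxV // mul1mx hIP //.
  by rewrite -mulmxA mulmxV // mulmx1.
have IP : I *m Pn = 1%:M by rewrite mulmxA mulmxV.
clearbody Pn; clear hP0 uIP hIP P.
pose Q := 1%:M - Pn *m I.
have IQ : I *m Q = 0 by rewrite mulmxBr mulmx1 mulmxA IP mul1mx subrr.
have QP : Q *m Pn = 0 by rewrite mulmxBl mul1mx -mulmxA IP mulmx1 subrr.
have QQ : Q *m Q = Q by rewrite {1}/Q mulmxBl mul1mx -mulmxA IQ mulmx0 subr0.
have [r [R [C [CRQ RC]]]] := idempotent_factor QQ.
have IC : I *m C = 0 by rewrite -[C]mulmx1 -RC !mulmxA -(mulmxA I) CRQ IQ mul0mx.
have RP : R *m Pn = 0 by rewrite -[R]mul1mx -RC -!mulmxA (mulmxA C) CRQ QP mulmx0.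
have Qcf i l : C *m R *m cf U i l = cf U i l *m (C *m R).
  rewrite CRQ; have [ld|dl] := ltnP l d; last by rewrite cf_large // mulmx0 mul0mx.
  rewrite -cf_modn // mulmxBl mulmxBr mul1mx mulmx1; congr (_ - _).
  by rewrite -mulmxA hI ?ltn_pmod // mulmxA hP ?ltn_pmod // mulmxA.
suff iso : comod_iso U (dsum S (retract RC Qcf)).
  by exists (retract RC Qcf); rewrite // (comod_iso_dim iso).
apply: (@comod_isoP _ _ _ U (dsum S (retract RC Qcf)) (row_mx Pn C) (col_mx I R)).
- move=> i l i_n ld; rewrite cf_dsum mul_row_block !mulmx0 addr0 add0r mul_mx_row.
  congr row_mx; first by rewrite hP.
  by rewrite /cf cfmx_retract // !mulmxA Qcf -!mulmxA RC mulmx1.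
- by rewrite mul_row_col CRQ /Q addrC subrK.
- by rewrite mul_col_row IP RC IC RP -scalar_mx_block.
Qed.

End Splitting.

(** * Ranks classify comodules *)

Section Classification.
Variables (k : fieldType) (n d : nat).
Hypotheses (n_gt0 : (0 < n)%N) (d_gt0 : (0 < d)%N).
Implicit Types U W S : comodule k n d.
Local Notation string := (string k n_gt0 d_gt0).

Lemma comod_iso_sym U W : comod_iso U W -> comod_iso W U.
Proof. by case=> F [G [hF hG FG GF]]; exists G, F. Qed.

Lemma comod_iso_trans U W S : comod_iso U W -> comod_iso W S -> comod_iso U S.
Proof.
move=> [F [G [/comod_homP hF _ FG GF]]] [F' [G' [/comod_homP hF' _ FG' GF']]].
apply: (@comod_isoP _ _ _ U S (F *m F') (G' *m G)).
- by move=> i l i_n ld; rewrite -mulmxA hF' // mulmxA hF // mulmxA.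
- by rewrite mulmxA -(mulmxA F) FG' mulmx1.
- by rewrite mulmxA -(mulmxA G') GF mulmx1.
Qed.

Lemma comod_iso_dsumr S U W : comod_iso U W -> comod_iso (dsum S U) (dsum S W).
Proof.
move=> [F [G [/comod_homP hF _ FG GF]]].
apply: (@comod_isoP _ _ _ (dsum S U) (dsum S W)
          (block_mx 1%:M 0 0 F) (block_mx 1%:M 0 0 G)).
- move=> i l i_n ld; rewrite !cf_dsum // !mulmx_block.
  by rewrite !(mulmx0, mul0mx, mul1mx, mulmx1, addr0, add0r) hF.
- by rewrite mulmx_block !(mulmx0, mul0mx, mul1mx, addr0, add0r) FG -scalar_mx_block.
- by rewrite mulmx_block !(mulmx0, mul0mx, mul1mx, addr0, add0r) GF -scalar_mx_block.
Qed.

Lemma cdim0_iso U W : cdim U = 0%N -> cdim W = 0%N -> comod_iso U W.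
Proof.
move=> U0 W0.
apply: (@comod_isoP _ _ _ U W 0 0); rewrite ?mul0mx.
- by move=> i l _ _; rewrite mul0mx mulmx0.
- by apply/matrixP => a; have := ltn_ord a; rewrite {2}U0.
- by apply/matrixP => a; have := ltn_ord a; rewrite {2}W0.
Qed.

Lemma rk_cdim0 U : (cdim U = 0)%N <-> (forall i, (i < n)%N -> rk U i 0 = 0%N).
Proof.
split=> [U0 i _|rk0].
  by apply/eqP; rewrite -leqn0 -[X in (_ <= X)%N]U0 rank_leq_row.
have : \rank (1%:M : 'M[k]_(cdim U)) = 0%N.
  rewrite -cf_sum1 // big1 ?mxrank0 // => i _.
  by apply/eqP; rewrite -mxrank_eq0 -/(rk U i 0) rk0.
by rewrite mxrank1.
Qed.

(** A path longer than [e] begins with a path of length [e.+1]. *)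
Lemma cf_top U e : (forall j, (j < n)%N -> rk U j e.+1 = 0%N) ->
  forall j l, (e < l)%N -> cf U j l = 0.
Proof.
move=> top j l el; have {el} -> : l = (e.+1 + (l - e.+1))%N by lia.
rewrite -cf_mulS // -(cf_modn _ j).
suff -> : cf U (j %% n) e.+1 = 0 by rewrite mul0mx.
by apply/eqP; rewrite -mxrank_eq0 -/(rk _ _ _) top ?ltn_pmod.
Qed.

(** A nonzero entry (a, b) of the longest path provides both maps: [I] sends the m-th basis vector
    of the string to the image of e_a after m arrows, and the m-th coordinate of [P] is the b-th
    coordinate after the remaining e - m arrows. They are comodule maps because longer paths
    vanish. *)
Lemma split_string U i e (ok : string_len d e.+1) : (e < d)%N ->
    (forall j, (j < n)%N -> rk U j e.+1 = 0%N) -> rk U i e != 0%N ->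
  exists2 K, comod_iso U (dsum (string i ok) K) & (cdim U = e.+1 + cdim K)%N.
Proof.
move=> ed /cf_top top; rewrite /rk mxrank_eq0 => cf_n0.
have [a [b ab_n0]] : exists a b, cf U i e a b != 0.
  suff /existsP[a /existsP[b ab]] : [exists a, exists b, cf U i e a b != 0].
    by exists a, b.
  apply: contraNT cf_n0 => /existsPn H; apply/eqP/matrixP => a b; rewrite [RHS]mxE.
  by have /existsPn/(_ b) := H a; rewrite negbK => /eqP.
pose I : 'M[k]_(e.+1, cdim U) := \matrix_(m < e.+1) row a (cf U i m).
pose P : 'M[k]_(cdim U, e.+1) :=
  \matrix_(x, m) cf U (i + m) (e - m) x b.
have IE m y : I m y = cf U i m a y by rewrite !mxE.
have PE x m : P x m = cf U (i + m) (e - m) x b by rewrite mxE.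
clearbody I P.
apply: (@split_off _ _ _ n_gt0 d_gt0 U (string i ok) I P).
- move=> j l jn ld; apply/matrixP => m x; rewrite !mxE.
  transitivity ((cf U i m *m cf U j l) a x).
    by rewrite mxE; apply: eq_bigr => y _; rewrite IE.
  rewrite cf_mul // mxE; under eq_bigr do rewrite cf_string // IE.
  have [ml|ml] := ltnP (m + l) e.+1; last first.
    rewrite top // mxE mulr0 big1 // => y _.
    by rewrite (ltn_eqF (leq_trans (ltn_ord y) ml)) mul0r.
  rewrite (bigD1 (Ordinal ml)) //= eqxx eq_sym big1 ?addr0 // => y ne.
  rewrite (_ : (y == m + l :> nat)%N = false) ?mul0r //.
  by apply: contraNF ne => /eqP yE; apply/eqP/val_inj.
- move=> j l jn ld; apply/matrixP => x m; rewrite !mxE.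
  transitivity ((cf U j l *m cf U (i + m) (e - m)) x b); last first.
    by rewrite mxE; apply: eq_bigr => y _; rewrite PE.
  rewrite cf_mul // mxE; under eq_bigr do rewrite cf_string // PE.
  have mE : (m <= e)%N by rewrite -ltnS.
  have [lm|ml] := leqP l m; last first.
    rewrite top ?mxE ?mulr0 ?big1 // => [y _|]; last by lia.
    by rewrite (ltn_eqF (ltn_addl y ml)) mulr0.
  have lm' : (m - l < e.+1)%N by lia.
  rewrite (bigD1 (Ordinal lm')) //= subnK // eqxx big1 ?addr0 => [|y ne]; last first.
    rewrite (_ : (m == y + l :> nat)%N = false) ?mulr0 //.
    apply: contraNF ne => /eqP yE; apply/eqP/val_inj => /=.
    by rewrite yE addnK.
  rewrite mulrC (_ : (i + m)%N = (i + (m - l) + l)%N) ?eqn_modDr; last by lia.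
  have [ej|_] := eqVneq ((i + (m - l)) %% n)%N (j %% n)%N; last by rewrite !mul0r.
  by rewrite !mul1r (cf_eqmod _ _ ej); congr (cf _ _ _ _ _); rewrite subnBA // addnBA // addnC.
- have IPE m x : (I *m P) m x = (x == m %[mod n])%:R * cf U i (m + (e - x)) a b.
    transitivity ((cf U i m *m cf U (i + x) (e - x)) a b).
      by rewrite !mxE; apply: eq_bigr => y _; rewrite IE PE.
    by rewrite cf_mul // mxE eqn_modDl.
  (* Below the diagonal [I *m P] involves paths longer than [e], which are zero, and on it every
     entry is the chosen nonzero one. The transpose is taken because [det_trig] is about lower
     triangular matrices. *)
  rewrite -unitmx_tr unitmxE det_trig.
    rewrite unitfE; apply/prodf_neq0 => m _; rewrite mxE IPE eqxx mul1r.
    by rewrite subnKC // -ltnS.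
  apply/is_trig_mxP => m x mx; rewrite mxE IPE top ?mxE ?mulr0 //.
  by rewrite addnBA ?ltn_subRL ?ltn_add2r // -ltnS.
Qed.

Lemma exists_top U : (0 < cdim U)%N ->
  exists i e, [/\ (i < n)%N, (e < d)%N, rk U i e != 0%N
                 & forall j, (j < n)%N -> rk U j e.+1 = 0%N].
Proof.
move=> U_gt0; pose Q e := [exists i : 'I_n, rk U i e != 0%N].
have Q0 : exists e, Q e.
  exists 0%N; apply/existsP; apply/existsP; apply: contraTT U_gt0 => /existsPn H.
  rewrite -leqNgt leqn0; apply/eqP/rk_cdim0 => i i_n.
  by apply/eqP; have := H (Ordinal i_n); rewrite negbK.
have Qd e : Q e -> (e <= d.-1)%N.
  case/existsP => i; rewrite -ltnS prednK //; apply: contraNT; rewrite -leqNgt => de.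
  by rewrite rk_large.
case: (ex_maxnP Q0 Qd) => e /existsP[i rk_n0] e_max.
exists i, e; split=> //; first by have := Qd e; rewrite -ltnS prednK //; apply; apply/existsP; exists i.
move=> j jn; apply/eqP; apply: contraT => rkj.
have : Q e.+1 by apply/existsP; exists (Ordinal jn).
by move/e_max; rewrite ltnn.
Qed.

(** Up to isomorphism every comodule is an iterated direct sum of strings, obtained by repeatedly
    splitting off a longest one. *)
Lemma comod_ind (P : comodule k n d -> Prop) :
    (forall U W, comod_iso U W -> P W -> P U) ->
    (forall U, cdim U = 0%N -> P U) ->
    (forall i e (ok : string_len d e.+1) K, (i < n)%N -> (e < d)%N ->
       P K -> P (dsum (string i ok) K)) ->
  forall U, P U.
Proof.
move=> P_iso P_0 P_string U; move: {2}(cdim U) (leqnn (cdim U)) => N.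
elim: N U => [|N IH] U leN; first by apply: P_0; apply/eqP; rewrite -leqn0.
have [U0|U_gt0] := posnP (cdim U); first exact: P_0.
have [i [e [i_n ed rk_n0 top]]] := exists_top U_gt0.
have ok : string_len d e.+1 by rewrite /string_len ed.
have [K isoK dimK] := split_string ok ed top rk_n0.
by apply: (P_iso _ _ isoK); apply: P_string => //; apply: IH; lia.
Qed.

(** The ranks show where a longest nonzero path starts, so both comodules split off the same string;
    its ranks cancel by additivity, and the complements are isomorphic by induction. *)
Lemma iso_of_rk U W :
  (forall i l, (i < n)%N -> (l < d)%N -> rk U i l = rk W i l) -> comod_iso U W.
Proof.
move: {2}(cdim U) (leqnn (cdim U)) => N.
elim: N U W => [|N IH] U W leN eq_rk.
  have U0 : cdim U = 0%N by apply/eqP; rewrite -leqn0.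
  by apply: cdim0_iso => //; apply/rk_cdim0 => i i_n; rewrite -eq_rk //; exact: (rk_cdim0 U).1.
have [U0|U_gt0] := posnP (cdim U).
  by apply: cdim0_iso => //; apply/rk_cdim0 => i i_n; rewrite -eq_rk //; exact: (rk_cdim0 U).1.
have [i [e [i_n ed rk_n0 top]]] := exists_top U_gt0.
have ok : string_len d e.+1 by rewrite /string_len ed.
have [K isoK dimK] := split_string ok ed top rk_n0.
have topW j : (j < n)%N -> rk W j e.+1 = 0%N.
  move=> jn; have [lt|le] := ltnP e.+1 d; last by rewrite rk_large.
  by rewrite -eq_rk // top.
have rkW : rk W i e != 0%N by rewrite -eq_rk.
have [L isoL dimL] := split_string ok ed topW rkW.
apply: (comod_iso_trans isoK (comod_iso_trans _ (comod_iso_sym isoL))).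
apply/comod_iso_dsumr/IH; first by lia.
move=> j l jn ld; apply/(@addnI (rk (string i ok) j l)).
by rewrite -!rk_dsum // -(rk_iso n_gt0 _ _ isoK) // -(rk_iso n_gt0 _ _ isoL) // eq_rk.
Qed.

End Classification.

(** * Tensor products of matrices *)

Section TensorMatrices.
Variable k : fieldType.

Lemma tensmx_suml (I : finType) m n p q (F : I -> 'M[k]_(m, n)) (B : 'M[k]_(p, q)) :
  (\sum_i F i) *t B = \sum_i F i *t B.
Proof.
apply/matrixP => a b; rewrite summxE mxE summxE mulr_suml.
by apply: eq_bigr => i _; rewrite mxE.
Qed.

Lemma tensmx_sumr (I : finType) m n p q (A : 'M[k]_(m, n)) (F : I -> 'M[k]_(p, q)) :
  A *t (\sum_i F i) = \sum_i A *t F i.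
Proof.
apply/matrixP => a b; rewrite summxE mxE summxE mulr_sumr.
by apply: eq_bigr => i _; rewrite mxE.
Qed.

Lemma tensmxZl m n p q c (A : 'M[k]_(m, n)) (B : 'M[k]_(p, q)) :
  (c *: A) *t B = c *: (A *t B).
Proof. by apply/matrixP => a b; rewrite !mxE mulrA. Qed.

Lemma tensmxZr m n p q c (A : 'M[k]_(m, n)) (B : 'M[k]_(p, q)) :
  A *t (c *: B) = c *: (A *t B).
Proof. by apply/matrixP => a b; rewrite !mxE mulrCA. Qed.

Lemma tens_mx1 m n : (1%:M : 'M[k]_m) *t (1%:M : 'M[k]_n) = 1%:M.
Proof.
apply/matrixP => a b; rewrite !mxE -natrM mulnb.
by congr (nat_of_bool _)%:R; rewrite -(can_eq (@mxtens_unindexK _ _)).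
Qed.

Lemma mxrank_cast m n m' n' (e : (m = m') * (n = n')) (A : 'M[k]_(m, n)) :
  \rank (castmx e A) = \rank A.
Proof. by case: e => e1 e2; case: m' / e1; case: n' / e2; rewrite castmx_id. Qed.

Lemma rank_tens1 m n (A : 'M[k]_(m, n)) : \rank ((1%:M : 'M[k]_1) *t A) = \rank A.
Proof. by rewrite tens_scalar_mx mxrank_cast scale1r. Qed.

Lemma tensmxA m n p q r s (A : 'M[k]_(m, n)) (B : 'M[k]_(p, q)) (C : 'M[k]_(r, s)) :
  A *t B *t C = castmx (mulnA _ _ _, mulnA _ _ _) (A *t (B *t C)).
Proof.
have E m1 m2 m3 (a1 : 'I_m1) (a2 : 'I_m2) (a3 : 'I_m3) (e : _ = _) :
    cast_ord e (mxtens_index (mxtens_index (a1, a2), a3))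
    = mxtens_index (a1, mxtens_index (a2, a3)).
  by apply: val_inj => /=; rewrite mulnDl -mulnA addnA.
apply/matrixP => a b; case: (mxtens_indexP a) => a12 a3; case: (mxtens_indexP b) => b12 b3.
case: (mxtens_indexP a12) => a1 a2; case: (mxtens_indexP b12) => b1 b2.
by rewrite castmxE /= !E !tensmxE mulrA.
Qed.

(** Block elimination: subtracting [T] times the first block row from the second, and then the
    second block column times [S] from the first, clears both diagonal blocks. Only [B] and - T B S
    remain, and [s] swaps the columns. *)
Lemma rank_block_factor N (B S T : 'M[k]_N) :
  \rank (block_mx (B *m S) B 0 (T *m B)) = (\rank B + \rank (T *m B *m S))%N.
Proof.
pose L : 'M[k]_(N + N) := block_mx 1%:M 0 (- T) 1%:M.
pose R : 'M[k]_(N + N) := block_mx 1%:M 0 (- S) 1%:M.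
pose s : 'M[k]_(N + N) := block_mx 0 1%:M 1%:M 0.
have uL : L \in unitmx.
  by rewrite unitmxE det_lblock !det1 mulr1 unitr1.
have uR : R \in unitmx by rewrite unitmxE det_lblock !det1 mulr1 unitr1.
have ss : s *m s = 1%:M.
  by rewrite mulmx_block !(mulmx0, mul0mx, mulmx1, addr0, add0r) -scalar_mx_block.
have us : s \in unitmx by case/mulmx1_unit: ss.
set A := block_mx _ _ _ _.
have LA : L *m A = block_mx (B *m S) B (- (T *m B *m S)) 0.
  rewrite mulmx_block !(mulmx0, mul0mx, mul1mx, mulmx1, addr0, add0r).
  by rewrite !mulNmx addNr mulmxA.
have LAR : L *m A *m R = block_mx 0 B (- (T *m B *m S)) 0.
  rewrite LA mulmx_block !(mulmx0, mul0mx, mul1mx, mulmx1, addr0, add0r).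
  by rewrite mulmxN subrr.
have : L *m A *m R *m s = block_mx B 0 0 (- (T *m B *m S)).
  by rewrite LAR mulmx_block !(mulmx0, mul0mx, mul1mx, mulmx1, addr0, add0r).
move/(congr1 mxrank); rewrite rank_diag_block_mx mxrank_opp => <-.
rewrite mxrankMfree ?row_free_unit // mxrankMfree ?row_free_unit //.
by rewrite eqmxMfull ?row_full_unit.
Qed.

End TensorMatrices.

(** * Ranks of tensor products *)

Section Tensor.
Variables (k : fieldType) (n : nat) (zeta : k) (s : nat) (q : k) (d : nat).
Hypothesis zetaP : n.-primitive_root zeta.
Hypothesis qP : q ^+ n = zeta ^+ s.
Hypothesis dP : d.-primitive_root q.
Implicit Types U W S : comodule k n d.

Let n_gt0 : (0 < n)%N := prim_order_gt0 zetaP.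
Let d_gt0 : (0 < d)%N := prim_order_gt0 dP.

Local Notation string := (string k n_gt0 d_gt0).
Local Notation tensor := (tensor zetaP qP dP).
Local Notation mc := (mul_coef n zeta s q).
Local Notation h := (zeta ^- s * q^-1).
Local Notation Z := (zeta ^+ s).

Lemma cf_tensor U W i l : (l < d)%N -> cf (tensor U W) i l =
  \sum_(b : 'I_n * 'I_d) \sum_(c : 'I_n * 'I_d)
    (mc b.1 b.2 c.1 c.2 * ((b.1 + c.1 == i %[mod n])%N && (b.2 + c.2 == l)%N)%:R)
      *: (cf U b.1 b.2 *t cf W c.1 c.2).
Proof.
move=> ld; apply/matrixP => x y; rewrite [LHS]mxE /= mxE mulME pcoef_sum summxE.
apply: eq_bigr => b _; rewrite pcoef_sum summxE; apply: eq_bigr => c _.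
by rewrite !pcoefZ pcoef_p // !mxE !pcoefE // mulrC.
Qed.

Lemma mul_scal_neq0 i l j m : mul_scal n zeta s q i l j m != 0.
Proof.
rewrite /mul_scal mulf_neq0 // expf_neq0 ?(Z_neq0 qP dP) //.
by rewrite (hE qP) invr_neq0 // expf_neq0 // (q_neq0 dP).
Qed.

Lemma gP1 N : gP k N 1 = qnat k N.
Proof.
elim: N => [|N IH]; first by rewrite gP_small // /qnat big_ord0.
by rewrite gPS gP0 IH [RHS](qnatD k 1 N) /qnat big_ord1 expr0.
Qed.

(** A zero would give h ^ m = 1, whereas h has order d. *)
Lemma qnat_h_neq0 m : (0 < m)%N -> (m < d)%N -> (qnat k m).[h] != 0.
Proof.
move=> m0 md; have hP := h_prim zetaP qP dP.
apply: contraTneq md => E; rewrite -leqNgt dvdn_leq // (prim_order_dvd hP).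
have : (h - 1) * (qnat k m).[h] = h ^+ m - 1.
  rewrite subrX1; congr (_ * _); rewrite /qnat horner_sum.
  by apply: eq_bigr => j _; rewrite hornerXn.
by rewrite E mulr0 => /esym/eqP; rewrite subr_eq0.
Qed.

Lemma mul_coef0_neq0 i j m : mc i 0 j m != 0.
Proof. by rewrite (mul_coefE _ _ zetaP) gP0 hornerC mulr1 mul_scal_neq0. Qed.

Lemma mul_coef1_neq0 i j m : (m.+1 < d)%N -> mc i 1 j m != 0.
Proof.
move=> md; rewrite (mul_coefE _ _ zetaP) mulf_neq0 ?mul_scal_neq0 // gP1.
exact: qnat_h_neq0.
Qed.

Section LeftString.
Variables (i t : nat) (ok : string_len d t) (W : comodule k n d).

(** The string leads from [a] to [b] only along the path of length [b - a] from [i + a], so at most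
    one term of the double sum survives; [z] is the vertex of [W] that completes [i + a] to [x]. *)
Lemma string_tensor_block x y (a b : 'I_t) (z : nat) u v :
    (y < d)%N -> (i + a + z = x %[mod n])%N ->
  cf (tensor (string i ok) W) x y (mxtens_index (a, u)) (mxtens_index (b, v)) =
  (if (a <= b)%N && (b - a <= y)%N
   then mc ((i + a) %% n)%N (b - a) (z %% n)%N (y - (b - a)) * cf W z (y - (b - a)) u v
   else 0).
Proof.
move=> yd zx; rewrite cf_tensor // summxE.
under eq_bigr => c _ do rewrite summxE.
under eq_bigr => c _ do under eq_bigr => e _ do rewrite mxE tensmxE cf_string //.
case: ifP => [/andP[ab bay]|nab]; last first.
  apply: big1 => c _; apply: big1 => e _.
  have [bE|_] := eqVneq (b : nat) (a + c.2)%N; last by rewrite mul0r mulr0.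
  have [yE|_] := eqVneq (c.2 + e.2)%N y; last by rewrite andbF mulr0 mul0r.
  by move: nab; rewrite bE leq_addr addKn -yE leq_addr.
have zin : (z %% n < n)%N by rewrite ltn_pmod.
have iin : ((i + a) %% n < n)%N by rewrite ltn_pmod.
have bad : (b - a < d)%N by apply: leq_ltn_trans yd.
have ybd : (y - (b - a) < d)%N by apply: leq_ltn_trans (leq_subr _ _) yd.
rewrite (bigD1 (Ordinal iin, Ordinal bad)) //= [X in _ + X]big1 ?addr0; last first.
  move=> c ne; apply: big1 => e _.
  rewrite (_ : (b == a + c.2 :> nat)%N && (i + a == c.1 %[mod n])%N = false) ?mul0r ?mulr0 //.
  apply: contraNF ne => /andP[/eqP bE /eqP ia].
  apply/eqP; case: c bE ia {e} => c1 c2 /= bE ia; congr (_, _); apply: val_inj => /=.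
    by rewrite ia modn_small.
  by rewrite bE addKn.
rewrite (bigD1 (Ordinal zin, Ordinal ybd)) //= [X in _ + X]big1 ?addr0; last first.
  move=> c ne; rewrite (_ : _ && _ = false) ?mul0r ?mulr0 ?mul0r //.
  apply: contraNF ne => /andP[/eqP bE /eqP yE].
  apply/eqP; case: c bE yE => c1 c2 /= bE yE; congr (_, _); apply: val_inj => /=.
    apply/eqP; rewrite -(modn_small (ltn_ord c1)) -(eqn_modDl (i + a)) zx.
    by rewrite -bE modnDml.
  by rewrite -yE addKn.
rewrite modnDm zx eqxx !subnKC // !eqxx modn_mod eqxx mulr1 mul1r.
by rewrite cf_modn.
Qed.

End LeftString.

Lemma rk_string1_tensor i (ok : string_len d 1) W x y z : (y < d)%N ->
    (i + z = x %[mod n])%N ->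
  rk (tensor (string i ok) W) x y = rk W z y.
Proof.
move=> yd zx; have zx' : (i + (ord0 : 'I_1) + z = x %[mod n])%N by rewrite addn0.
have E : cf (tensor (string i ok) W) x y
       = mc (i %% n)%N 0 (z %% n)%N y *: ((1%:M : 'M_1) *t cf W z y).
  apply/matrixP => a b; case: (mxtens_indexP a) => a1 a2; case: (mxtens_indexP b) => b1 b2.
  rewrite (ord1 a1) (ord1 b1) (string_tensor_block _ _ _ _ yd zx') //.
  rewrite [RHS]mxE tensmxE [1%:M _ _]mxE.
  by rewrite eqxx mul1r !subn0 addn0.
by rewrite /rk E mxrank_scale_nz ?mul_coef0_neq0 // rank_tens1.
Qed.
Section LeftString2.
Variables (ok : string_len d 2) (W : comodule k n d).
Local Notation w := (cdim W).

(** The basis vectors of the string lie over the vertices 0 and 1, so the diagonal blocks are paths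
    of [W] from [x] and from [z]. The arrow of the string gives the off-diagonal block and leaves
    one arrow less for [W]. *)
Lemma string2_tensor_cf x y z : (y < d)%N -> (1 + z = x %[mod n])%N ->
  cf (tensor (string 0 ok) W) x y =
  castmx (esym (mul2n w) , esym (mul2n w)) (castmx (addnn w, addnn w)
    (block_mx (mc 0 0 (x %% n) y *: cf W x y)
              (if (0 < y)%N then mc 0 1 (x %% n) y.-1 *: cf W x y.-1 else 0)
              0 (mc (1 %% n) 0 (z %% n) y *: cf W z y))).
Proof.
move=> yd zx; rewrite castmx_comp.
have x0 : (0 + (ord0 : 'I_2) + x = x %[mod n])%N by [].
have z1 : (0 + (lift ord0 ord0 : 'I_2) + z = x %[mod n])%N by [].
have E0 (e : (2 * w = w + w)%N) u :
    cast_ord e (mxtens_index (ord0 : 'I_2, u)) = lshift w u by exact: val_inj.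
have E1 (e : (2 * w = w + w)%N) u :
    cast_ord e (mxtens_index (lift ord0 ord0 : 'I_2, u)) = rshift w u.
  by apply: val_inj; rewrite /= mul1n.
have case2 (a : 'I_2) : a = ord0 \/ a = lift ord0 ord0.
  by case: a => -[|[|//]] p; [left|right]; apply: val_inj.
apply/matrixP => a b; case: (mxtens_indexP a) => a1 a2; case: (mxtens_indexP b) => b1 b2.
rewrite castmxE /=.
have [-> | ->] := case2 a1; have [-> | ->] := case2 b1;
  rewrite ?E0 ?E1 ?(block_mxEul, block_mxEur, block_mxEdl, block_mxEdr).
- by rewrite (string_tensor_block _ _ _ _ yd x0) //= !subn0 mod0n [RHS]mxE.
- rewrite (string_tensor_block _ _ _ _ yd x0) //= /bump /= subn0 mod0n.
  by case: ltnP => y0; rewrite [RHS]mxE // subn1.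
- by rewrite (string_tensor_block _ _ _ _ yd z1) //= [RHS]mxE.
- by rewrite (string_tensor_block _ _ _ _ yd z1) //= /bump /= subnn subn0 [RHS]mxE.
Qed.

(** For y > 0 both diagonal blocks factor through the off-diagonal path of length y - 1 from [x]:
    one appends an arrow, the other prepends the arrow from [z]. Doing both gives the path of length
    y + 1 from [z], whose rank is the second term of [rank_block_factor]. For y = 0 the matrix is
    block diagonal. *)
Lemma rk_string2_tensor x y z : (y < d)%N -> (1 + z = x %[mod n])%N ->
  rk (tensor (string 0 ok) W) x y =
  if (0 < y)%N then (rk W x y.-1 + rk W z y.+1)%N else (rk W x 0 + rk W z 0)%N.
Proof.
move=> yd zx; rewrite {1}/rk (string2_tensor_cf yd zx) !mxrank_cast.
case: ltnP => [y0|]; last first.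
  rewrite leqn0 => /eqP ->.
  by rewrite rank_diag_block_mx !mxrank_scale_nz ?mul_coef0_neq0.
set al := mc 0 0 _ _; set be := mc 0 1 _ _; set ga := mc _ 0 _ _.
(* Up to a nonzero scalar, [be] is the h-integer y, and 0 < y < d. *)
have be_n0 : be != 0 by rewrite mul_coef1_neq0 // prednK.
pose B := be *: cf W x y.-1.
pose S := (al / be) *: cf W (x + y.-1) 1.
pose T := (ga / be) *: cf W z 1.
have BS : B *m S = al *: cf W x y.
  rewrite -scalemxAl -scalemxAr scalerA cf_mulS // addn1 prednK //.
  by rewrite mulrC divfK.
have Tx m : cf W z 1 *m cf W x m = cf W z m.+1.
  by rewrite cf_mul // addnC zx eqxx scale1r.
have TB : T *m B = ga *: cf W z y.
  by rewrite -scalemxAl -scalemxAr scalerA Tx prednK // divfK.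
have TBS : T *m B *m S = (ga * (al / be)) *: cf W z y.+1.
  rewrite TB -scalemxAl -scalemxAr scalerA; congr (_ *: _).
  have e : (x + y.-1 = z + y %[mod n])%N.
    by rewrite -modnDml -zx modnDml; congr (_ %% n)%N; lia.
  by rewrite (cf_eqmod _ _ e) cf_mulS // addn1.
rewrite -BS -/B -TB rank_block_factor TBS /rk !mxrank_scale_nz //.
by rewrite mulf_neq0 ?mul_coef0_neq0 // mulf_neq0 ?invr_eq0 ?mul_coef0_neq0.
Qed.

End LeftString2.
End Tensor.

(** * Tensor products, isomorphisms and direct sums; associativity of the coefficients *)

Section TensorInvariants.
Variables (k : fieldType) (n : nat) (zeta : k) (s : nat) (q : k) (d : nat).
Hypothesis zetaP : n.-primitive_root zeta.
Hypothesis qP : q ^+ n = zeta ^+ s.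
Hypothesis dP : d.-primitive_root q.
Implicit Types U W S : comodule k n d.

Let n_gt0 : (0 < n)%N := prim_order_gt0 zetaP.
Let d_gt0 : (0 < d)%N := prim_order_gt0 dP.

Local Notation tensor := (tensor zetaP qP dP).
Local Notation mc := (mul_coef n zeta s q).
Local Notation h := (zeta ^- s * q^-1).
Local Notation Z := (zeta ^+ s).

Lemma tensor_isol U U' W : comod_iso U U' -> comod_iso (tensor U W) (tensor U' W).
Proof.
move=> [F [G [/comod_homP hF _ FG GF]]].
apply: (@comod_isoP _ _ _ (tensor U W) (tensor U' W) (F *t 1%:M) (G *t 1%:M)).
- move=> i l _ ld; rewrite !cf_tensor // mulmx_sumr mulmx_suml; apply: eq_bigr => b _.
  rewrite mulmx_sumr mulmx_suml; apply: eq_bigr => c _.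
  by rewrite -scalemxAr -scalemxAl !tensmx_mul mul1mx mulmx1 hF.
- by rewrite tensmx_mul FG mulmx1 tens_mx1.
- by rewrite tensmx_mul GF mulmx1 tens_mx1.
Qed.

Lemma cast_index_lshift a1 a2 r (i : 'I_a1) (u : 'I_r)
    (e : ((a1 + a2) * r = a1 * r + a2 * r)%N) :
  cast_ord e (mxtens_index (lshift a2 i, u)) = lshift _ (mxtens_index (i, u)).
Proof. exact: val_inj. Qed.

Lemma cast_index_rshift a1 a2 r (i : 'I_a2) (u : 'I_r)
    (e : ((a1 + a2) * r = a1 * r + a2 * r)%N) :
  cast_ord e (mxtens_index (rshift a1 i, u)) = rshift _ (mxtens_index (i, u)).
Proof. by apply: val_inj; rewrite /= mulnDl addnA. Qed.

Lemma rk_tensor_dsuml U U' W x y :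
  rk (tensor (dsum U U') W) x y = (rk (tensor U W) x y + rk (tensor U' W) x y)%N.
Proof.
rewrite /rk -rank_diag_block_mx.
have cfE X a1 a2 b1 b2 : cf (tensor X W) x y (mxtens_index (a1, a2)) (mxtens_index (b1, b2))
    = pcoef x y (mulM zeta s q (coact X a1 b1) (coact W a2 b2)).
  by rewrite mxE /= mxE !mxtens_indexK.
have mul0M (f : M k n d) : mulM zeta s q 0 f = 0.
  by rewrite mulME big1 // => a _; rewrite big1 // => b _; rewrite ffunE mul0r scale0r.
set B := block_mx _ _ _ _.
suff -> : cf (tensor (dsum U U') W) x y
  = castmx (esym (mulnDl _ _ _), esym (mulnDl _ _ _)) B by rewrite mxrank_cast.
apply/matrixP => a b; case: (mxtens_indexP a) => a1 a2; case: (mxtens_indexP b) => b1 b2.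
rewrite castmxE [LHS]cfE /= /dsum_coact.
case: (split_ordP a1) => {}a1 ->; case: (split_ordP b1) => {}b1 ->;
  rewrite ?cast_index_lshift ?cast_index_rshift;
  rewrite !(block_mxEul, block_mxEur, block_mxEdl, block_mxEdr).
- by rewrite cfE.
- by rewrite !mxE mul0M pcoef0.
- by rewrite !mxE mul0M pcoef0.
- by rewrite cfE.
Qed.

(** Both sides are the Gaussian multinomial coefficient of (a, b, c): multiplied by the three
    factorials they give that of a + b + c. *)
Lemma gP_assoc a b c :
  gP k (a + b) a * gP k (a + b + c) (a + b) = gP k (b + c) b * gP k (a + (b + c)) a.
Proof.
have n0 : qfact k a * qfact k b * qfact k c != 0 by rewrite !mulf_neq0 ?qfact_neq0.
apply: (mulIf n0).
transitivity (qfact k (a + b + c)).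
  by rewrite [RHS]qfact_gP qfact_gP; ring.
by rewrite -addnA qfact_gP qfact_gP; ring.
Qed.

(* The scalar Z^(i [(j + r) / n]), depending only on the vertices, is the associator of
   M(n, s, q). *)
Lemma mul_coef_assoc i l j m r t : (i < n)%N -> (j < n)%N -> (r < n)%N ->
  Z ^+ (i * ((j + r) %/ n)) * (mc i l ((j + r) %% n)%N (m + t) * mc j m r t) =
  mc i l j m * mc ((i + j) %% n)%N (l + m) r t
  * Z ^+ (((i + l) %% n) * (((j + m) %% n + (r + t) %% n) %/ n)).
Proof.
move=> i_n j_n r_n; rewrite !(mul_coefE _ _ zetaP).
have gA : (gP k (l + (m + t)) l).[h] * (gP k (m + t) m).[h]
        = (gP k (l + m) l).[h] * (gP k (l + m + t) (l + m)).[h].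
  by rewrite -!hornerM -/h gP_assoc mulrC.
set g1 := (gP k (l + (m + t)) l).[h] in gA *.
set g2 := (gP k (m + t) m).[h] in gA *.
set g3 := (gP k (l + m) l).[h] in gA *.
set g4 := (gP k (l + m + t) (l + m)).[h] in gA *.
suff sA : Z ^+ (i * ((j + r) %/ n)) * (mul_scal n zeta s q i l ((j + r) %% n) (m + t)
                   * mul_scal n zeta s q j m r t)
        = mul_scal n zeta s q i l j m * mul_scal n zeta s q ((i + j) %% n) (l + m) r t
  * Z ^+ (((i + l) %% n) * (((j + m) %% n + (r + t) %% n) %/ n)).
  transitivity (Z ^+ (i * ((j + r) %/ n)) * (mul_scal n zeta s q i l ((j + r) %% n) (m + t)
                   * mul_scal n zeta s q j m r t) * (g1 * g2)); first by ring.
  by rewrite sA gA; ring.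
rewrite /mul_scal.
(* Since h ^ n is the inverse of Z, reducing j + r modulo n costs a power of Z. *)
have -> : h ^+ ((j + r) %% n * l) = h ^+ ((j + r) * l) * Z ^+ ((j + r) %/ n * l).
  by rewrite exprM (hmod zetaP qP dP) exprMn -(exprM h) -(exprM Z).
rewrite (mulnDl ((i + j) %% n)%N) (exprD Z) !(Zmod _ zetaP).
(* Both sides are the quotient of j + r + m + t by n, computed with two different groupings. *)
have fl : ((m + t + (j + r) %% n) %/ n + (j + r) %/ n
        = (m + j) %/ n + (t + r) %/ n + ((j + m) %% n + (r + t) %% n) %/ n)%N.
  have e1 := divn_eq (j + r) n; have e2 := divn_eq (m + j) n; have e3 := divn_eq (t + r) n.
  transitivity ((m + t + (j + r)) %/ n)%N.
    by rewrite [in RHS]e1 addnCA divnMDl // addnC.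
  have -> : (m + t + (j + r) = ((m + j) %/ n + (t + r) %/ n) * n
                               + ((j + m) %% n + (r + t) %% n))%N.
    by rewrite (addnC j m) (addnC r t); lia.
  by rewrite divnMDl.
move: fl; set T := ((m + t + _) %/ n)%N; set C := ((j + r) %/ n)%N.
set C' := ((m + j) %/ n)%N; set E := ((t + r) %/ n)%N; set D := ((_ + _) %/ n)%N => fl.
have ZE : Z ^+ (i * C) * Z ^+ (C * l) * Z ^+ ((i + l) * T)
        = Z ^+ ((i + l) * C') * Z ^+ ((i + l) * E) * Z ^+ ((i + l) * D).
  rewrite -!exprD; congr (_ ^+ _).
  by rewrite -!mulnDr -fl (mulnC C l) -mulnDl -mulnDr (addnC C).
transitivity (Z ^+ (i * C) * Z ^+ (C * l) * Z ^+ ((i + l) * T)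
              * (h ^+ ((j + r) * l) * h ^+ (r * m) * Z ^+ ((j + m) * E))); first by ring.
rewrite ZE !mulnDl !mulnDr !exprD; ring.
Qed.

End TensorInvariants.

(** * Associativity *)

Lemma castmx_lin (k : fieldType) (I : finType) m p m' p' (e : (m = m') * (p = p'))
    (c : I -> k) (A : I -> 'M[k]_(m, p)) :
  castmx e (\sum_i c i *: A i) = \sum_i c i *: castmx e (A i).
Proof.
case: e => e1 e2; case: m' / e1; case: p' / e2; rewrite castmx_id.
by apply: eq_bigr => i _; rewrite castmx_id.
Qed.

Section Associativity.
Variables (k : fieldType) (n : nat) (zeta : k) (s : nat) (q : k) (d : nat).
Hypothesis zetaP : n.-primitive_root zeta.
Hypothesis qP : q ^+ n = zeta ^+ s.
Hypothesis dP : d.-primitive_root q.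

Let n_gt0 : (0 < n)%N := prim_order_gt0 zetaP.
Let d_gt0 : (0 < d)%N := prim_order_gt0 dP.

Local Notation tensor := (tensor zetaP qP dP).
Local Notation mc := (mul_coef n zeta s q).
Local Notation Z := (zeta ^+ s).
Local Notation D := ('I_n * 'I_d)%type.

Variables U V W : comodule k n d.

(** The sum runs over the possible intermediate products, of which only the path [b] matches. If its
    length is at least d, no index matches, and the hypothesis on [Q] makes the right-hand side zero
    too. *)
Lemma sum_over_product (b : nat * nat) (G : nat -> nat -> k) (Q : nat -> nat -> bool) :
    (forall l, Q (b.1 %% n)%N l -> (l < d)%N) ->
  \sum_(f : D) G f.1 f.2 * ((b.1 == f.1 %[mod n])%N && (b.2 == f.2)%N)%:R
      * (Q f.1 f.2)%:R
  = G (b.1 %% n)%N b.2 * (Q (b.1 %% n)%N b.2)%:R.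
Proof.
move=> Qd; have [ld|dl] := ltnP b.2 d; last first.
  have -> : Q (b.1 %% n)%N b.2 = false.
    by apply: contraTF dl => /Qd; rewrite -ltnNge.
  rewrite mulr0 big1 // => f _.
  by rewrite (gtn_eqF (leq_trans (ltn_ord f.2) dl)) andbF mulr0 mul0r.
have i_n : (b.1 %% n < n)%N by rewrite ltn_pmod.
rewrite (bigD1 (Ordinal i_n, Ordinal ld)) //= modn_mod !eqxx mulr1.
rewrite big1 ?addr0 // => f ne.
rewrite (_ : _ && _ = false) ?mulr0 ?mul0r //.
apply: contraNF ne => /andP[/eqP e1 /eqP e2].
apply/eqP; case: f e1 e2 => f1 f2 /= e1 e2; congr (_, _); apply: val_inj => //=.
by rewrite e1 modn_small.
Qed.

Definition hit3 (b c e : D) x y :=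
  (b.1 + c.1 + e.1 == x %[mod n])%N && (b.2 + c.2 + e.2 == y)%N.

Lemma cf_tensor3l x y : (y < d)%N -> cf (tensor (tensor U V) W) x y =
  \sum_(t : D * D * D)
    (mc t.1.1.1 t.1.1.2 t.1.2.1 t.1.2.2
      * mc ((t.1.1.1 + t.1.2.1) %% n)%N (t.1.1.2 + t.1.2.2) t.2.1 t.2.2
      * (hit3 t.1.1 t.1.2 t.2 x y)%:R)
    *: (cf U t.1.1.1 t.1.1.2 *t cf V t.1.2.1 t.1.2.2 *t cf W t.2.1 t.2.2).
Proof.
move=> yd; rewrite cf_tensor //.
transitivity (\sum_(f : D) \sum_(e : D) \sum_(bc : D * D)
  ((mc f.1 f.2 e.1 e.2 * ((f.1 + e.1 == x %[mod n])%N && (f.2 + e.2 == y)%N)%:R)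
   * (mc bc.1.1 bc.1.2 bc.2.1 bc.2.2
      * ((bc.1.1 + bc.2.1 == f.1 %[mod n])%N && (bc.1.2 + bc.2.2 == f.2)%N)%:R))
   *: (cf U bc.1.1 bc.1.2 *t cf V bc.2.1 bc.2.2 *t cf W e.1 e.2)).
  apply: eq_bigr => f _; apply: eq_bigr => e _.
  rewrite cf_tensor // pair_big tensmx_suml scaler_sumr; apply: eq_bigr => bc _.
  by rewrite tensmxZl scalerA.
rewrite exchange_big; under eq_bigr do rewrite exchange_big.
rewrite exchange_big pair_big; apply: eq_bigr => -[[b c] e] _ /=.
rewrite -scaler_suml; congr (_ *: _).
have := @sum_over_product ((b.1 + c.1, b.2 + c.2)%N)
  (fun f1 f2 => mc b.1 b.2 c.1 c.2 * mc f1 f2 e.1 e.2)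
  (fun f1 f2 => (f1 + e.1 == x %[mod n])%N && (f2 + e.2 == y)%N).
rewrite /= modnDml /hit3 => <-; last by move=> l /andP[_ /eqP E]; lia.
by apply: eq_bigr => f _; ring.
Qed.

Lemma cf_tensor3r x y : (y < d)%N -> cf (tensor U (tensor V W)) x y =
  \sum_(t : D * D * D)
    (mc t.1.1.1 t.1.1.2 ((t.1.2.1 + t.2.1) %% n)%N (t.1.2.2 + t.2.2)
      * mc t.1.2.1 t.1.2.2 t.2.1 t.2.2
      * (hit3 t.1.1 t.1.2 t.2 x y)%:R)
    *: (cf U t.1.1.1 t.1.1.2 *t (cf V t.1.2.1 t.1.2.2 *t cf W t.2.1 t.2.2)).
Proof.
move=> yd; rewrite cf_tensor //.
transitivity (\sum_(b : D) \sum_(f : D) \sum_(ce : D * D)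
  ((mc b.1 b.2 f.1 f.2 * ((b.1 + f.1 == x %[mod n])%N && (b.2 + f.2 == y)%N)%:R)
   * (mc ce.1.1 ce.1.2 ce.2.1 ce.2.2
      * ((ce.1.1 + ce.2.1 == f.1 %[mod n])%N && (ce.1.2 + ce.2.2 == f.2)%N)%:R))
   *: (cf U b.1 b.2 *t (cf V ce.1.1 ce.1.2 *t cf W ce.2.1 ce.2.2))).
  apply: eq_bigr => b _; apply: eq_bigr => f _.
  rewrite (cf_tensor _ _ _ V W) // pair_big tensmx_sumr scaler_sumr; apply: eq_bigr => ce _.
  by rewrite tensmxZr scalerA.
under eq_bigr do rewrite exchange_big.
rewrite pair_big /=.
rewrite [LHS](reindex (fun t : D * D * D => (t.1.1, (t.1.2, t.2)))) /=; last first.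
  by exists (fun t => (t.1, t.2.1, t.2.2)) => [[[? ?] ?]|[? [? ?]]].
apply: eq_bigr => -[[b c] e] _ /=.
rewrite -scaler_suml; congr (_ *: _).
have := @sum_over_product ((c.1 + e.1, c.2 + e.2)%N)
  (fun f1 f2 => mc b.1 b.2 f1 f2 * mc c.1 c.2 e.1 e.2)
  (fun f1 f2 => (b.1 + f1 == x %[mod n])%N && (b.2 + f2 == y)%N).
rewrite /= modnDmr addnA (addnA b.2) /hit3 => <-.
  by apply: eq_bigr => f _; ring.
by move=> l /andP[_ /eqP E]; lia.
Qed.

Section Diagonal.
Variable om : nat -> nat -> nat -> k.

(** The vertex idempotents decompose U (x) V (x) W into components indexed by three vertices; this
    operator scales each component by [om]. *)
Definition diag3 := \sum_(t : 'I_n * 'I_n * 'I_n)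
  om t.1.1 t.1.2 t.2 *: (cf U t.1.1 0 *t cf V t.1.2 0 *t cf W t.2 0).

Lemma diag3_mull b c e l m r : (b < n)%N -> (c < n)%N -> (e < n)%N ->
  diag3 *m (cf U b l *t cf V c m *t cf W e r)
  = om b c e *: (cf U b l *t cf V c m *t cf W e r).
Proof.
move=> bn cn en; rewrite mulmx_suml.
rewrite (bigD1 (Ordinal bn, Ordinal cn, Ordinal en)) //= big1 ?addr0.
  by rewrite -scalemxAl !tensmx_mul !cf_mul // !addn0 !eqxx !scale1r.
move=> [[b' c'] e'] ne; rewrite -scalemxAl !tensmx_mul !cf_mul // !addn0.
rewrite !tensmxZl !tensmxZr !tensmxZl [X in _ *: X]scalerA [X in _ *: X]scalerA -!natrM !mulnb scalerA.
rewrite (_ : _ && _ = false) ?mulr0 ?scale0r //.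
apply: contraNF ne; rewrite !modn_small // => /andP[/andP[/eqP e1 /eqP e2] /eqP e3].
by apply/eqP; congr (_, _, _); apply: val_inj => /=.
Qed.

Lemma diag3_mulr b c e l m r :
  (cf U b l *t cf V c m *t cf W e r) *m diag3
  = om ((b + l) %% n)%N ((c + m) %% n)%N ((e + r) %% n)%N
    *: (cf U b l *t cf V c m *t cf W e r).
Proof.
have lt i : (i %% n < n)%N by rewrite ltn_pmod.
rewrite mulmx_sumr.
rewrite (bigD1 (Ordinal (lt (b + l)%N), Ordinal (lt (c + m)%N), Ordinal (lt (e + r)%N))) //=.
rewrite big1 ?addr0.
  by rewrite -scalemxAr !tensmx_mul !cf_mul // !addn0 !modn_mod !eqxx !scale1r.
move=> [[b' c'] e'] ne; rewrite -scalemxAr !tensmx_mul !cf_mul // !addn0.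
rewrite !tensmxZl !tensmxZr !tensmxZl [X in _ *: X]scalerA [X in _ *: X]scalerA -!natrM !mulnb scalerA.
rewrite (_ : _ && _ = false) ?mulr0 ?scale0r //.
apply: contraNF ne => /andP[/andP[/eqP e1 /eqP e2] /eqP e3].
by apply/eqP; congr (_, _, _); apply: val_inj; rewrite /= -?e1 -?e2 -?e3 modn_small.
Qed.

End Diagonal.

(** By [mul_coef_assoc] the operator [diag3 om] intertwines the two bracketings, and it is
    invertible because the scalars [om] are nonzero. *)
Lemma rk_tensorA x y : rk (tensor (tensor U V) W) x y = rk (tensor U (tensor V W)) x y.
Proof.
have [yd|dy] := ltnP y d; last by rewrite !rk_large.
pose om i j r : k := Z ^+ (i * ((j + r) %/ n)).
have om_neq0 i j r : om i j r != 0 by rewrite expf_neq0 // (Z_neq0 qP dP).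
have om_unit : diag3 om *m diag3 (fun i j r => (om i j r)^-1) = 1%:M.
  rewrite mulmx_sumr.
  transitivity (\sum_(t : 'I_n * 'I_n * 'I_n) cf U t.1.1 0 *t cf V t.1.2 0 *t cf W t.2 0).
    apply: eq_bigr => -[[i j] r] _ /=.
    by rewrite -scalemxAr diag3_mull // scalerA mulVf // scale1r.
  rewrite -(pair_big xpredT xpredT (fun (p : 'I_n * 'I_n) (r : 'I_n) => cf U p.1 0 *t cf V p.2 0 *t cf W r 0)) /=.
  rewrite -(pair_big xpredT xpredT (fun (i j : 'I_n) =>
    \sum_(r < n) cf U i 0 *t cf V j 0 *t cf W r 0)) /=.
  transitivity ((\sum_(i < n) cf U i 0) *t (\sum_(j < n) cf V j 0) *t (\sum_(r < n) cf W r 0)).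
    rewrite tensmx_suml tensmx_suml; apply: eq_bigr => i _.
    rewrite [cf U i 0 *t _]tensmx_sumr tensmx_suml; apply: eq_bigr => j _.
    by rewrite tensmx_sumr.
  by rewrite !cf_sum1 // !tens_mx1.
have [om_l _] := mulmx1_unit om_unit.
rewrite /rk -[RHS](mxrank_cast (mulnA _ _ _, mulnA _ _ _)) cf_tensor3r // castmx_lin.
under [in RHS]eq_bigr do rewrite -tensmxA.
rewrite -[LHS](mxrankMfree _ (B := diag3 om)) ?row_free_unit //.
rewrite -[RHS](eqmxMfull _ (A := diag3 om)) ?row_full_unit //.
congr (\rank _); rewrite cf_tensor3l // mulmx_suml mulmx_sumr.
apply: eq_bigr => -[[b c] e] _ /=.
rewrite -scalemxAl -scalemxAr diag3_mull // diag3_mulr !scalerA; congr (_ *: _).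
rewrite /om mulrAC -(mul_coef_assoc zetaP qP dP) //; ring.
Qed.
End Associativity.

(** * A class function valued in a commutative ring *)

Lemma sum_shift (R : zmodType) n i (F : nat -> R) :
  (forall j, F (j + n)%N = F j) -> \sum_(j < n) F (j + i)%N = \sum_(j < n) F j.
Proof.
move=> Fn; elim: i => [|i IH]; first by apply: eq_bigr => j _; rewrite addn0.
rewrite -{}IH; case: n Fn => [|n] Fn; first by rewrite !big_ord0.
rewrite big_ord_recr big_ord_recl /= add0n addrC addnS -addSn addnC Fn; congr (_ + _).
by apply: eq_bigr => j _; rewrite addnS.
Qed.

(** Two-step induction on [t]: the last hypothesis is the recurrence of [f] with the shift of [i] in
    place of [X]. Commutation is assumed only between [X] and [Y], as the lemma is also applied in
    the Green ring before that ring is known to be commutative. *)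
Lemma fib_like_family (R : pzRingType) (d : nat) (X Y w : R) (f : nat -> R)
    (phi : nat -> nat -> R) :
  GRing.comm X Y ->
  f 0%N = 0 -> f 1%N = 1 -> (forall t, f t.+2 = Y * f t.+1 - X * f t) ->
  (forall i, phi i 0%N = 0) -> (forall i, phi i 1%N = X ^+ i * w) ->
  (forall i t, (t.+2 <= d)%N -> Y * phi i t.+1 = phi i t.+2 + phi i.+1 t) ->
  forall i t, (t <= d)%N -> phi i t = X ^+ i * f t * w.
Proof.
move=> XY f0 f1 fS phi0 phi1 phiS i t.
suff: (t <= d)%N -> (forall i, phi i t = X ^+ i * f t * w) /\
    ((t.+1 <= d)%N -> forall i, phi i t.+1 = X ^+ i * f t.+1 * w).
  by move=> H td; have [-> _] := H td.
move=> {i}; elim: t => [|t IH] td.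
  by split=> [i|_ i]; rewrite ?phi0 ?phi1 ?f0 ?f1 ?mulr0 ?mul0r ?mulr1.
have [IH0 IH1] := IH (ltnW td); split=> [|td2] i; first exact: IH1.
have /eqP := phiS i t td2; rewrite -subr_eq => /eqP <-.
rewrite IH0 IH1 // fS mulrBr mulrBl; congr (_ - _).
  by rewrite !mulrA (commrX i (commr_sym XY)).
by rewrite exprSr !mulrA.
Qed.

Section RankClass.
Variables (Q : comNzRingType) (n d : nat) (X Y : Q) (f : nat -> Q).
Hypothesis d_gt0 : (0 < d)%N.
Hypothesis Xn : X ^+ n = 1.
Hypotheses (f0 : f 0%N = 0) (f1 : f 1%N = 1).
Hypothesis fS : forall t, f t.+2 = Y * f t.+1 - X * f t.
Hypothesis fd : (Y - X - 1) * f d = 0.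

(** The value at 0 is separate, since the general formula gives 0 there. With these weights the
    string with [t] vertices starting at [i] has class X ^ i * f t, see [cls_str]. *)
Definition weight l : Q := if l is 0 then 1 else (Y - X - 1) * f l.

Definition rank_class (r : nat -> nat -> nat) : Q :=
  \sum_(i < n) \sum_(l < d) (r i l)%:R * (X ^+ i * weight l).

Lemma rank_class_eq r r' :
  (forall i l, (i < n)%N -> (l < d)%N -> r i l = r' i l) -> rank_class r = rank_class r'.
Proof. by move=> E; apply: eq_bigr => i _; apply: eq_bigr => l _; rewrite E. Qed.

Lemma rank_class_add r r' :
  rank_class (fun i l => r i l + r' i l)%N = rank_class r + rank_class r'.
Proof.
rewrite -big_split; apply: eq_bigr => i _; rewrite -big_split; apply: eq_bigr => l _.
by rewrite natrD mulrDl.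
Qed.

Lemma rank_class_shift i r : (forall j l, r (j + n)%N l = r j l) ->
  rank_class r = X ^+ i * rank_class (fun j l => r (j + i)%N l).
Proof.
move=> rn; rewrite /rank_class.
rewrite -(@sum_shift _ _ i (fun j => \sum_(l < d) (r j l)%:R * (X ^+ j * weight l))) => [|j].
  rewrite mulr_sumr; apply: eq_bigr => j _; rewrite mulr_sumr; apply: eq_bigr => l _.
  by rewrite exprD; ring.
by apply: eq_bigr => l _; rewrite rn exprD Xn mulr1.
Qed.

(** The shifts of [l] by one in both directions reproduce Y * f by the recurrence. The terms at l =
    0 combine through 1 + X + (Y - X - 1) = Y, and at the upper end (Y - X - 1) * f d = 0. *)
Lemma weight_mulY (r : nat -> nat) : (forall l, (d <= l)%N -> r l = 0%N) ->
  \sum_(l < d) (if (0 < l)%N then r l.-1 else r 0%N)%:R * weight l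
  + X * (\sum_(l < d) (if (0 < l)%N then r l.+1 else r 0%N)%:R * weight l)
  = Y * (\sum_(l < d) (r l)%:R * weight l).
Proof.
move=> r_large; have wd : (Y - X - 1) * f d.-1.+1 = 0 by rewrite prednK.
have rd : r d.-1.+1 = 0%N by rewrite prednK // r_large.
rewrite -(prednK d_gt0); move: d.-1 wd rd => e wd re {r_large}.
set z := Y - X - 1 in wd *.
(* A last summand with the factor z * f d = 0 is added, then the first is split off with f 1 = 1. *)
have A : \sum_(i < e) (r i)%:R * (z * f i.+1)
       = (r 0%N)%:R * z + \sum_(i < e) (r i.+1)%:R * (z * f i.+2).
  transitivity (\sum_(i < e.+1) (r i)%:R * (z * f i.+1)).
    by rewrite big_ord_recr /= wd mulr0 addr0.
  by rewrite big_ord_recl f1 mulr1.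
(* The sum is extended below by f 0 = 0 and cut above by r d = 0. *)
have B : \sum_(i < e) (r i.+2)%:R * (z * f i.+1) = \sum_(i < e) (r i.+1)%:R * (z * f i).
  transitivity (\sum_(i < e.+1) (r i.+1)%:R * (z * f i)).
    by rewrite big_ord_recl f0 !mulr0 add0r.
  by rewrite big_ord_recr /= re mul0r addr0.
have C : Y * (\sum_(i < e) (r i.+1)%:R * (z * f i.+1))
       = \sum_(i < e) (r i.+1)%:R * (z * f i.+2)
         + X * (\sum_(i < e) (r i.+1)%:R * (z * f i)).
  rewrite !mulr_sumr -big_split; apply: eq_bigr => i _ /=.
  by rewrite fS; ring.
rewrite !big_ord_recl /= -/z.
transitivity ((r 0%N)%:R * 1 + (\sum_(i < e) (r i)%:R * (z * f i.+1))
   + X * ((r 0%N)%:R * 1 + (\sum_(i < e) (r i.+2)%:R * (z * f i.+1)))) => //.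
rewrite A B [RHS]mulrDr [X in _ = _ + X]C /z; ring.
Qed.

End RankClass.

(** * The two generators, and their products with strings *)

Section GreenRing.
Variables (k : fieldType) (n : nat) (zeta : k) (s : nat) (q : k) (d : nat).
Hypothesis zetaP : n.-primitive_root zeta.
Hypothesis qP : q ^+ n = zeta ^+ s.
Hypothesis dP : d.-primitive_root q.
Implicit Types U W : comodule k n d.

Let n_gt0 : (0 < n)%N := prim_order_gt0 zetaP.
Let d_gt0 : (0 < d)%N := prim_order_gt0 dP.

Local Notation tensor := (tensor zetaP qP dP).

Lemma string_len_min t : string_len d (minn t d).
Proof. by rewrite /string_len geq_minr. Qed.

Lemma string_len1 : string_len d 1.
Proof. by rewrite /string_len d_gt0. Qed.

Lemma string_len2 : string_len d 2.
Proof. by rewrite /string_len; case: (d) d_gt0 => [|[|e]]. Qed.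

(* For t <= d this is [V i (t - 1)], or 0 if t = 0. *)
Definition str i t := string k n_gt0 d_gt0 i (string_len_min t).
Definition gen_x := string k n_gt0 d_gt0 1 string_len1.
Definition gen_y := string k n_gt0 d_gt0 0 string_len2.

Lemma rk_str i t x y : (t <= d)%N -> (y < d)%N ->
  rk (str i t) x y = (\sum_(a < t - y) (i + a == x %[mod n])%N)%N.
Proof. by move=> td yd; rewrite rk_string // (minn_idPl td). Qed.

(** The vertex x - 1 modulo n, avoiding truncated subtraction at 0. *)
Definition pred_mod x := (x + n.-1)%N.

Lemma pred_modE x : (1 + pred_mod x = x %[mod n])%N.
Proof. by rewrite /pred_mod addnCA add1n prednK // modnDr. Qed.

Lemma eq_pred_mod i x : (i == pred_mod x %[mod n])%N = (i.+1 == x %[mod n])%N.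
Proof. by rewrite -(eqn_modDl 1) pred_modE add1n. Qed.

Lemma rk_gen_x_tensor W x y : rk (tensor gen_x W) x y = rk W (pred_mod x) y.
Proof.
have [yd|dy] := ltnP y d; last by rewrite !rk_large.
exact: rk_string1_tensor (pred_modE x).
Qed.

Lemma rk_gen_y_tensor W x y : (y < d)%N -> rk (tensor gen_y W) x y =
  if (0 < y)%N then (rk W x y.-1 + rk W (pred_mod x) y.+1)%N
  else (rk W x 0 + rk W (pred_mod x) 0)%N.
Proof. by move=> yd; apply: rk_string2_tensor (pred_modE x). Qed.

Lemma rk_gen_y_str i t x y : (t.+2 <= d)%N -> (y < d)%N ->
  rk (tensor gen_y (str i t.+1)) x y = (rk (str i t.+2) x y + rk (str i.+1 t) x y)%N.
Proof.
move=> td yd; have td1 : (t.+1 <= d)%N by lia.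
have td0 : (t <= d)%N by lia.
rewrite rk_gen_y_tensor // (rk_str i _ td) // (rk_str i.+1 _ td0) //.
case: (posnP y) => [y0|y_gt0].
  (* The vertices i, ..., i + t and i + 1, ..., i + t + 1 are regrouped as i, ..., i + t + 1 and i +
     1, ..., i + t. *)
  rewrite !rk_str // y0 !subn0 [in RHS]big_ord_recr /=.
  under [X in (_ + X)%N = _]eq_bigr do rewrite eq_pred_mod -addSn.
  by rewrite [X in (_ + X)%N = _]big_ord_recr /= addSnnS; lia.
rewrite (rk_str i _ td1); last by lia.
have -> : (t.+1 - y.-1 = t.+2 - y)%N by lia.
congr (_ + _)%N; have [yd'|yd'] := ltnP y.+1 d; last first.
  by rewrite rk_large // (_ : (t - y = 0)%N) ?big_ord0 //; lia.
rewrite rk_str // subSS.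
by apply: eq_bigr => a _; rewrite eq_pred_mod addSn.
Qed.

(** At the maximal length d no longer string can arise, and the product has the ranks of two strings
    of length d. This is the origin of the relation (y - x - 1) f_d = 0. *)
Lemma rk_gen_y_str_top i x y : (y < d)%N ->
  rk (tensor gen_y (str i d)) x y = (rk (str i d) x y + rk (str i.+1 d) x y)%N.
Proof.
move=> yd; rewrite rk_gen_y_tensor // !(rk_str _ _ (leqnn d) yd).
case: (posnP y) => [y0|y_gt0].
  rewrite !rk_str // y0 !subn0; congr (_ + _)%N; apply: eq_bigr => a _.
  by rewrite eq_pred_mod addSn.
rewrite (rk_str i x (leqnn d)); last by lia.
have -> : rk (str i d) (pred_mod x) y.+1 = (\sum_(a < d - y.+1) (i.+1 + a == x %[mod n])%N)%N.
  have [yd'|yd'] := ltnP y.+1 d; last by rewrite rk_large // (_ : (d - _ = 0)%N) ?big_ord0 //; lia.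
  by rewrite rk_str //; apply: eq_bigr => a _; rewrite eq_pred_mod addSn.
have -> : (d - y.-1 = (d - y).+1)%N by lia.
have -> : (d - y = (d - y.+1).+1)%N by lia.
by rewrite big_ord_recr /= [X in _ = (_ + X)%N]big_ord_recr /= addSnnS; lia.
Qed.

(** Commutativity is verified on the generators only; it spreads to the whole Green ring in
    [bijective_of_presentation]. *)
Lemma rk_gen_yx x y : (y < d)%N ->
  rk (tensor gen_y gen_x) x y = rk (tensor gen_x gen_y) x y.
Proof.
move=> yd; rewrite rk_gen_x_tensor rk_gen_y_tensor //.
case: y yd => [|y] yd /=.
  rewrite !rk_string // !subn0 !big_ord1 big_ord_recl big_ord1 /= !addn0 add0n eq_pred_mod.
  by rewrite eq_pred_mod.
rewrite (rk_string k n_gt0 d_gt0 1 string_len1 _ (ltnW yd)) (rk_string k n_gt0 d_gt0 0 string_len2 _ yd).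
have -> : rk gen_x (pred_mod x) y.+2 = 0%N.
  have [yd'|] := ltnP y.+2 d; last exact: rk_large.
  by rewrite rk_string // big_ord0.
rewrite addn0 subSS; case: y yd => [|y] yd; last by rewrite !big_ord0.
by rewrite !big_ord1 eq_pred_mod.
Qed.

Lemma str_iso i t (ok : string_len d t) : (t <= d)%N ->
  comod_iso (string k n_gt0 d_gt0 i ok) (str i t).
Proof.
move=> td; apply: (iso_of_rk n_gt0 d_gt0) => x y _ yd.
by rewrite rk_str // rk_string.
Qed.

Lemma comod_str_ind (P : comodule k n d -> Prop) :
    (forall U W, comod_iso U W -> P W -> P U) ->
    (forall U, cdim U = 0%N -> P U) ->
    (forall i t, (t <= d)%N -> P (str i t)) ->
    (forall U W, P U -> P W -> P (dsum U W)) ->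
  forall U, P U.
Proof.
move=> P_iso P_0 P_str P_dsum; apply: (@comod_ind _ _ _ n_gt0 d_gt0 P) => // i e ok K _ ed PK.
by apply: P_dsum => //; apply: P_iso (str_iso i ok ed) (P_str _ _ ed).
Qed.

Lemma rk_cdim0_eq0 U x y : cdim U = 0%N -> rk U x y = 0%N.
Proof. by move=> U0; apply/eqP; rewrite -leqn0 -[leqRHS]U0 rank_leq_row. Qed.

Lemma cdim_str0 i : cdim (str i 0) = 0%N.
Proof. by rewrite /= min0n. Qed.

(** * The class of a comodule, and its multiplicativity *)

Section ClassFunction.
Variables (Q : comNzRingType) (X Y : Q) (f : nat -> Q).
Hypothesis Xn : X ^+ n = 1.
Hypotheses (f0 : f 0%N = 0) (f1 : f 1%N = 1).
Hypothesis fS : forall t, f t.+2 = Y * f t.+1 - X * f t.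
Hypothesis fd : (Y - X - 1) * f d = 0.

Definition cls U := rank_class n d X Y f (rk U).

Lemma cls_rk U W : (forall x y, (y < d)%N -> rk U x y = rk W x y) -> cls U = cls W.
Proof. by move=> E; apply: rank_class_eq => i l _; apply: E. Qed.

Lemma cls_iso U W : comod_iso U W -> cls U = cls W.
Proof. by move=> iso; apply: cls_rk => x y _; apply: rk_iso iso. Qed.

Lemma cls_add U1 U2 W : (forall x y, (y < d)%N -> rk W x y = (rk U1 x y + rk U2 x y)%N) ->
  cls W = cls U1 + cls U2.
Proof. by move=> E; rewrite -rank_class_add; apply: rank_class_eq => i l _; apply: E. Qed.

Lemma cls_dsum U W : cls (dsum U W) = cls U + cls W.
Proof. by apply: cls_add => x y _; rewrite rk_dsum. Qed.

Lemma cls_cdim0 U : cdim U = 0%N -> cls U = 0.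
Proof.
move=> U0; apply: big1 => i _; apply: big1 => l _.
by rewrite rk_cdim0_eq0 // mul0r.
Qed.

Lemma rk_addn U x y : rk U (x + n) y = rk U x y.
Proof. by rewrite -rk_modn modnDr rk_modn. Qed.

Lemma cls_shift U W i :
  (forall x y, (y < d)%N -> rk U (x + i) y = rk W x y) -> cls U = X ^+ i * cls W.
Proof.
move=> E; rewrite /cls (rank_class_shift _ _ _ Xn i) => [|x y]; last exact: rk_addn.
by congr (_ * _); apply: rank_class_eq => x y _; apply: E.
Qed.

Lemma cls_str1_tensor i W : cls (tensor (str i 1) W) = X ^+ i * cls W.
Proof.
rewrite -(cls_iso (tensor_isol zetaP qP dP W (str_iso i string_len1 d_gt0))).
by apply: cls_shift => x y yd; apply: rk_string1_tensor; rewrite // addnC.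
Qed.

(** The ranks of the product split into a part at [x] and a part at [x - 1]. Shifting the latter
    back produces a factor [X], and [weight_mulY] then applies vertex by vertex. *)
Lemma cls_gen_y_tensor W : cls (tensor gen_y W) = Y * cls W.
Proof.
pose r1 x y := (if (0 < y)%N then rk W x y.-1 else rk W x 0)%N.
pose r2 x y := (if (0 < y)%N then rk W (pred_mod x) y.+1 else rk W (pred_mod x) 0)%N.
have -> : cls (tensor gen_y W) = rank_class n d X Y f r1 + rank_class n d X Y f r2.
  rewrite -rank_class_add; apply: rank_class_eq => i l _ ld.
  by rewrite rk_gen_y_tensor // /r1 /r2; case: ifP.
have pn x y : rk W (pred_mod (x + n)) y = rk W (pred_mod x) y.
  by rewrite /pred_mod addnAC rk_addn.
rewrite (rank_class_shift _ _ _ Xn 1 (r := r2)) => [|x y]; last by rewrite /r2 !pn.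
rewrite expr1 /cls /rank_class !mulr_sumr -big_split; apply: eq_bigr => i _ /=.
have rW y : (d <= y)%N -> rk W i y = 0%N by apply: rk_large.
have p1 y : rk W (pred_mod (i + 1)) y = rk W i y.
  by rewrite /pred_mod -addnA add1n prednK // rk_addn.
have E := weight_mulY d_gt0 f0 f1 fS fd rW.
transitivity (X ^+ i * (Y * (\sum_(l < d) (rk W i l)%:R * weight X Y f l))).
  rewrite -E mulrDr (mulrCA _ X) !mulr_sumr -!mulr_sumr.
  congr (_ + _).
    by rewrite mulr_sumr; apply: eq_bigr => l _; rewrite /r1 mulrCA.
  congr (_ * _); rewrite mulr_sumr; apply: eq_bigr => l _.
  by rewrite /r2 !p1 mulrCA.
rewrite mulrCA; congr (_ * _); rewrite mulr_sumr.
by apply: eq_bigr => l _; rewrite mulrCA.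
Qed.

(** Associativity moves [gen_y] next to the string, where [rk_gen_y_str] gives the recurrence
    required by [fib_like_family]. *)
Lemma cls_str_tensor i t W : (t <= d)%N ->
  cls (tensor (str i t) W) = X ^+ i * f t * cls W.
Proof.
move: i t; apply: (@fib_like_family _ d X Y (cls W) f (fun i t => cls (tensor (str i t) W))) => //.
- exact: mulrC.
- move=> i; apply: cls_cdim0.
  by rewrite [LHS](_ : _ = (cdim (str i 0) * cdim W)%N) // cdim_str0.
- move=> i. exact: (cls_str1_tensor i W).
- move=> i t td; rewrite -cls_gen_y_tensor.
  rewrite (_ : cls (tensor gen_y _) = cls (tensor (tensor gen_y (str i t.+1)) W)).
    rewrite (_ : cls (tensor (tensor _ _) _)
               = cls (tensor (dsum (str i t.+2) (str i.+1 t)) W)).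
      by apply: cls_add => x y _; apply: rk_tensor_dsuml.
    apply/cls_iso/tensor_isol/(iso_of_rk n_gt0 d_gt0) => x y _ yd.
    by rewrite rk_gen_y_str // rk_dsum.
  by apply: cls_rk => x y _; rewrite rk_tensorA.
Qed.

Lemma cls_string i : cls (string k n_gt0 d_gt0 i string_len1) = X ^+ i.
Proof.
rewrite /cls (rank_class_shift _ _ _ Xn i); last exact: rk_addn.
rewrite -[RHS]mulr1; congr (_ * _).
rewrite /rank_class (bigD1 (Ordinal n_gt0)) //= [X in _ + X]big1 ?addr0; last first.
  move=> x ne; apply: big1 => y _; rewrite rk_string //.
  case: (y : nat) => [|l]; last by rewrite big_ord0 mul0r.
  rewrite big_ord1 addn0 -{1}(add0n i) eqn_modDr (_ : _ == _ = false) ?mul0r //.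
  apply: contraNF ne; rewrite mod0n (modn_small (ltn_ord x)) => /eqP E.
  by apply/eqP/val_inj.
rewrite (bigD1 (Ordinal d_gt0)) //= [X in _ + X]big1 ?addr0; last first.
  move=> y ne; rewrite rk_string // (_ : (1 - y = 0)%N) ?big_ord0 ?mul0r //.
  have : (y : nat) != 0%N by apply: contraNneq ne => E; apply/eqP/val_inj.
  by lia.
by rewrite rk_string // big_ord1 addn0 eqxx mul1r mul1r.
Qed.

Lemma cls_str1 i : cls (str i 1) = X ^+ i.
Proof. by rewrite -(cls_iso (str_iso i string_len1 d_gt0)) cls_string. Qed.

Lemma cls_str i t : (t <= d)%N -> cls (str i t) = X ^+ i * f t.
Proof.
move=> td; rewrite -[RHS]mulr1; move: i t td.
apply: (@fib_like_family _ d X Y 1 f (fun i t => cls (str i t))) => //.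
- exact: mulrC.
- by move=> i; apply/cls_cdim0/cdim_str0.
- by move=> i; rewrite mulr1 cls_str1.
- move=> i t td; rewrite -cls_gen_y_tensor; apply: cls_add => x y yd.
  exact: rk_gen_y_str.
Qed.

(** Both sides are additive and isomorphism invariant in [U], which reduces the claim to strings. *)
Lemma cls_tensor U W : cls (tensor U W) = cls U * cls W.
Proof.
move: U; apply: comod_str_ind => [U U' iso IH|U U0|i t td|U U' IH IH'].
- by rewrite (cls_iso iso) -IH; apply/cls_iso/tensor_isol.
- rewrite (cls_cdim0 U0) mul0r; apply: cls_cdim0.
  by rewrite [LHS](_ : _ = (cdim U * cdim W)%N) // U0.
- by rewrite cls_str_tensor // cls_str.
- rewrite cls_dsum mulrDl -IH -IH'.
  by apply: cls_add => x y _; apply: rk_tensor_dsuml.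
Qed.

Lemma cls_gen_x : cls gen_x = X.
Proof. exact: cls_string. Qed.

(** [gen_y] has the ranks of its product with the unit [str 0 1]. Unlike [cls_str] at length 2, this
    comparison covers d = 1. *)
Lemma cls_gen_y : cls gen_y = Y.
Proof.
rewrite -[RHS]mulr1 -[X in Y * X](expr0 X) -(cls_str1 0) -cls_gen_y_tensor.
apply: cls_rk => x y yd; rewrite rk_gen_y_tensor //.
have r1 z w : (w < d)%N -> rk (str 0 1) z w = (\sum_(a < 1 - w) (0 + a == z %[mod n])%N)%N.
  by move=> wd; rewrite rk_str.
case: y yd => [|y] yd; rewrite /= rk_string //.
  by rewrite !r1 // !subn0 !big_ord1 big_ord_recl big_ord1 /= eq_pred_mod.
have -> : rk (str 0 1) (pred_mod x) y.+2 = 0%N.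
  have [yd'|] := ltnP y.+2 d; last exact: rk_large.
  by rewrite r1 // big_ord0.
by rewrite (r1 _ _ (ltnW yd)) addn0 subSS.
Qed.

End ClassFunction.
End GreenRing.

(** * The quotient ring *)

Section Quotient.
Variables n d : nat.
Local Notation Q := {ideal_quot J n d}.

Definition piJ (P : {mpoly int[2]}) : Q := (\pi_Q P)%qT.

HB.instance Definition _ := GRing.RMorphism.copy piJ (\pi_Q)%qT.

Lemma piJ0 P : piJ P = 0 <-> P \in J n d.
Proof.
rewrite -(rmorph0 piJ) /piJ; split=> [/eqP|H]; last apply/eqP.
  by rewrite -Quotient.idealrBE subr0.
by rewrite -Quotient.idealrBE subr0.
Qed.

Lemma piJ_rel1 : piJ 'X_(0 : 'I_2) ^+ n = 1.
Proof.
apply/eqP; rewrite -subr_eq0; apply/eqP.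
have -> : piJ 'X_(0 : 'I_2) ^+ n - 1 = piJ ('X_(0 : 'I_2) ^+ n - 1).
  by rewrite rmorphB rmorphXn rmorph1.
apply/piJ0; rewrite unfold_in; apply/asboolP; exists 1, 0.
by rewrite mul1r mul0r addr0.
Qed.

Lemma fibS t : fib t.+2 = 'X_(1 : 'I_2) * fib t.+1 - 'X_(0 : 'I_2) * fib t.
Proof. by case: t => [|t] //=; rewrite mulr1 mulr0 subr0. Qed.

Lemma piJ_fibS t :
  piJ (fib t.+2) = piJ 'X_(1 : 'I_2) * piJ (fib t.+1) - piJ 'X_(0 : 'I_2) * piJ (fib t).
Proof. by rewrite fibS rmorphB !rmorphM. Qed.

Lemma piJ_rel2 : (piJ 'X_(1 : 'I_2) - piJ 'X_(0 : 'I_2) - 1) * piJ (fib d) = 0.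
Proof.
have -> : (piJ 'X_(1 : 'I_2) - piJ 'X_(0 : 'I_2) - 1) * piJ (fib d)
  = piJ (('X_(1 : 'I_2) - 'X_(0 : 'I_2) - 1) * fib d).
  by rewrite rmorphM !rmorphB rmorph1.
apply/piJ0; rewrite unfold_in; apply/asboolP; exists 0, 1.
by rewrite mul1r mul0r add0r.
Qed.

(** Evaluation [psi] at (X, Y) is onto because [X] and [Y] generate, and it kills [J] because they
    satisfy its relations. Since phi after psi is the projection, phi is onto, and its kernel is the
    image of [J] under [psi], which is zero. *)
Lemma bijective_of_presentation (R : nzRingType) (phi : {rmorphism R -> Q}) (X Y : R)
    (f : nat -> R) :
  GRing.comm X Y -> X ^+ n = 1 ->
  f 0%N = 0 -> f 1%N = 1 -> (forall t, f t.+2 = Y * f t.+1 - X * f t) ->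
  (Y - X - 1) * f d = 0 ->
  phi X = piJ 'X_(0 : 'I_2) -> phi Y = piJ 'X_(1 : 'I_2) ->
  (forall S : R -> Prop, S 1 -> (forall a b, S a -> S b -> S (a - b)) ->
     (forall a b, S a -> S b -> S (a * b)) -> S X -> S Y -> forall a, S a) ->
  bijective phi.
Proof.
move=> XY Xn f0 f1 fS fd phiX phiY gen.
pose v (i : 'I_2) : R := if i == 0 then X else Y.
pose psi : {mpoly int[2]} -> R := mmap intr v.
(* The elements commuting with both generators form a subring containing them, hence all of [R].
   This makes the evaluation multiplicative. *)
have central a : GRing.comm a X /\ GRing.comm a Y.
  apply: (gen (fun a => GRing.comm a X /\ GRing.comm a Y)) => [|b c [bX bY] [cX cY]|b c [bX bY] [cX cY]||] //.
  - by split; apply/commr_sym/commr1.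
  - by split; apply/commr_sym; apply: commrB; apply/commr_sym.
  - by split; apply/commr_sym; apply: commrM; apply/commr_sym.
have comm_v i a : GRing.comm a (v i) by rewrite /v; have [? ?] := central a; case: ifP.
have psiM : monoid_morphism psi.
  have [] : multiplicative psi; last by split.
  apply: commr_mmap_is_multiplicative => [i x|P m1 m2]; first exact: comm_v.
  exact/commr_sym/commr_int.
have psiB : zmod_morphism psi by move=> P P'; rewrite /psi mmapB.
pose psiR : {rmorphism {mpoly int[2]} -> R} := HB.pack psi
  (GRing.isZmodMorphism.Build _ _ psi psiB) (GRing.isMonoidMorphism.Build _ _ psi psiM).
have psiX i : psiR 'X_i = v i by rewrite /= /psi mmapX mmap1U.
have phi_psi P : phi (psiR P) = piJ P.
  elim/mpolyind: P => [|c m P _ _ IH]; first by rewrite !rmorph0.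
  rewrite !rmorphD IH; congr (_ + _).
  rewrite -mul_mpolyC mpolyXE_id !rmorphM !rmorph_prod.
  have -> : c%:MP = c%:~R :> {mpoly int[2]} by rewrite -[in LHS](intz c) rmorph_int.
  rewrite !rmorph_int; congr (_ * _); apply: eq_bigr => i _.
  rewrite !rmorphXn psiX; congr (_ ^+ _); rewrite /v.
  by case: i => [[|[|i]] lt] //=; rewrite ?(phiX, phiY); congr (piJ 'X_ _); apply: val_inj.
have psi_onto a : exists P, a = psiR P.
  apply: (gen (fun a => exists P, a = psiR P)).
  - by exists 1; rewrite rmorph1.
  - by move=> _ _ [P ->] [P' ->]; exists (P - P'); rewrite rmorphB.
  - by move=> _ _ [P ->] [P' ->]; exists (P * P'); rewrite rmorphM.
  - by exists 'X_(0 : 'I_2); rewrite psiX.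
  - by exists 'X_(1 : 'I_2); rewrite psiX.
have psi_fib t : psiR (fib t) = f t.
  suff [] : psiR (fib t) = f t /\ psiR (fib t.+1) = f t.+1 by [].
  elim: t => [|t [IH0 IH1]]; first by rewrite f0 f1 rmorph0 rmorph1.
  by split=> //; rewrite fibS rmorphB !rmorphM IH0 IH1 !psiX fS.
have psi_J P : P \in J n d -> psiR P = 0.
  rewrite unfold_in => /asboolP[a [b ->]].
  rewrite rmorphD !rmorphM !rmorphB rmorphXn rmorph1 !psiX psi_fib.
  by rewrite /v /= Xn subrr mulr0 fd mulr0 addr0.
have phi_inj : injective phi.
  move=> a b; have [P ->] := psi_onto a; have [P' ->] := psi_onto b.
  rewrite !phi_psi => E; apply/eqP; rewrite -subr_eq0 -rmorphB; apply/eqP/psi_J/piJ0.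
  by rewrite rmorphB /= E subrr.
have phi_onto b : exists a, phi a == b.
  by exists (psiR (repr b)); rewrite phi_psi; apply/eqP/reprK.
exists (fun b => xchoose (phi_onto b)) => [a|b]; last exact/eqP/(xchooseP (phi_onto b)).
by apply: phi_inj; apply/eqP/(xchooseP (phi_onto (phi a))).
Qed.
End Quotient.

(** * The isomorphism *)

Section Isomorphism.
Variables (k : fieldType) (n : nat) (zeta : k) (s : nat) (q : k) (d : nat).
Hypothesis zetaP : n.-primitive_root zeta.
Hypothesis qP : q ^+ n = zeta ^+ s.
Hypothesis dP : d.-primitive_root q.
Implicit Types U W : comodule k n d.

Let n_gt0 : (0 < n)%N := prim_order_gt0 zetaP.
Let d_gt0 : (0 < d)%N := prim_order_gt0 dP.

Local Notation tensor := (tensor zetaP qP dP).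
Local Notation G := (green_ring zetaP qP dP).
Local Notation Q := {ideal_quot J n d}.
Local Notation gr := (gr zetaP qP dP).
Local Notation cl U := (gr (Cls U) : G).
Local Notation str := (str zetaP dP).
Local Notation gen_x := (gen_x zetaP dP).
Local Notation gen_y := (gen_y zetaP dP).

Lemma gr_rk U W : (forall x y, (y < d)%N -> rk U x y = rk W x y) -> (cl U) = cl W.
Proof.
move=> E; apply/grP/Ge_iso/(iso_of_rk n_gt0 d_gt0) => x y _; exact: E.
Qed.

Lemma gr_dsum U W : cl (dsum U W) = cl U + cl W.
Proof. by rewrite [RHS]gr_addE; apply/esym/grP/Ge_dsum. Qed.

Lemma gr_tensor U W : cl (tensor U W) = cl U * cl W.
Proof. by rewrite [RHS]gr_mulE; apply/esym/grP/Ge_tensor. Qed.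

Lemma gr_add U1 U2 W : (forall x y, (y < d)%N -> rk W x y = (rk U1 x y + rk U2 x y)%N) ->
  (cl W) = cl U1 + cl U2.
Proof. by move=> E; rewrite -gr_dsum; apply: gr_rk => x y yd; rewrite E // rk_dsum. Qed.

(** All ranks of [U] are zero, so [U] = [U] + [U]. *)
Lemma gr_cdim0 U : cdim U = 0%N -> (cl U) = 0.
Proof.
move=> U0; apply: (addIr (cl U)); rewrite add0r; apply/esym/gr_add => x y _.
by rewrite rk_cdim0_eq0.
Qed.

Lemma gr_str01 : cl (str 0 1) = 1.
Proof.
transitivity (cl (V k (Ordinal n_gt0) (Ordinal d_gt0))); last exact/grP/Ge_unit.
apply/grP/Ge_iso/(comod_iso_trans (comod_iso_sym (str_iso zetaP dP 0 (string_len1 dP) d_gt0))).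
exact: (@string_V _ _ _ _ _ (Ordinal n_gt0) (Ordinal d_gt0)).
Qed.

Lemma gr_gen_x_str i t : (t <= d)%N -> (cl gen_x) * cl (str i t) = cl (str i.+1 t).
Proof.
move=> td; rewrite -gr_tensor; apply: gr_rk => x y yd.
rewrite rk_gen_x_tensor !rk_str //.
by apply: eq_bigr => a _; rewrite (eq_pred_mod zetaP).
Qed.

Lemma gr_str1 i : cl (str i 1) = cl gen_x ^+ i.
Proof.
elim: i => [|i IH]; first by rewrite gr_str01.
by rewrite exprS -IH gr_gen_x_str.
Qed.

Lemma gr_gen_x_n : cl gen_x ^+ n = 1.
Proof.
rewrite -gr_str1 -gr_str01; apply: gr_rk => x y yd; rewrite !rk_str //.
by apply: eq_bigr => a _; rewrite modnDl.
Qed.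

Lemma gr_gen_comm : GRing.comm (cl gen_x) (cl gen_y).
Proof.
by rewrite /GRing.comm -!gr_tensor; apply/esym/gr_rk => x y; apply: rk_gen_yx.
Qed.

(** The values of [fib] at the classes of [gen_x] and [gen_y], given by recursion because [G]
    carries only the structure of a possibly noncommutative ring. *)
Fixpoint gr_fib t : G :=
  match t with
  | 0 => 0
  | 1 => 1
  | (t''.+1 as t').+1 => (cl gen_y) * gr_fib t' - (cl gen_x) * gr_fib t''
  end.

Lemma gr_str i t : (t <= d)%N -> (cl (str i t)) = cl gen_x ^+ i * gr_fib t.
Proof.
move=> td; rewrite -[RHS]mulr1; move: i t td.
apply: (@fib_like_family _ d (cl gen_x) (cl gen_y) 1 gr_fib (fun i t => cl (str i t))) => //.
- exact: gr_gen_comm.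
- by move=> i; apply/gr_cdim0/cdim_str0.
- by move=> i; rewrite mulr1 gr_str1.
- move=> i t td; rewrite -gr_tensor; apply: gr_add => x y yd.
  exact: rk_gen_y_str.
Qed.

(** Here [gr_fib d] is the class of [str 0 d], whose product with [gen_y] is the sum of itself and
    its shift by [gen_x]. *)
Lemma gr_fib_rel : (cl gen_y - cl gen_x - 1) * gr_fib d = 0.
Proof.
have Ed i : cl (str i d) = cl gen_x ^+ i * gr_fib d by apply: gr_str.
rewrite -[gr_fib d]mul1r -(expr0 (cl gen_x)) -Ed !mulrBl mul1r -gr_tensor.
rewrite (gr_add (rk_gen_y_str_top zetaP qP dP 0)) gr_gen_x_str //.
by rewrite addrK subrr.
Qed.

(** Every comodule class is a sum of classes of strings, and these are polynomials in the two
    generators by [gr_str]. *)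
Lemma green_gen (S : G -> Prop) : S 1 -> (forall a b, S a -> S b -> S (a - b)) ->
  (forall a b, S a -> S b -> S (a * b)) -> S (cl gen_x) -> S (cl gen_y) -> forall a, S a.
Proof.
move=> S1 SB SM Sx Sy.
have S0 : S 0 by rewrite -(subrr 1); apply: SB.
have SN a : S a -> S (- a) by move=> Sa; rewrite -sub0r; apply: SB.
have SD a b : S a -> S b -> S (a + b) by move=> Sa Sb; rewrite -[b]opprK; apply/SB/SN.
have SX a i : S a -> S (a ^+ i) by move=> Sa; elim: i => [|i IH]; rewrite ?exprS //; apply: SM.
have Sf t : S (gr_fib t).
  suff [] : S (gr_fib t) /\ S (gr_fib t.+1) by [].
  by elim: t => [|t [IH0 IH1]]; split=> //; apply: SB; apply: SM.
have SU U : S (cl U).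
  move: U; apply: (comod_str_ind (zetaP := zetaP) (dP := dP)) => [U W iso SW|U U0|i t td|U W SU SW].
  - by rewrite (_ : cl U = cl W) //; apply/grP/Ge_iso.
  - by rewrite gr_cdim0.
  - by rewrite gr_str //; apply: SM; first exact: SX.
  - by rewrite gr_dsum; apply: SD.
elim/gr_ind; elim=> [U| | |a IH|a IHa b IHb|a IHa b IHb]; first exact: SU.
- exact: S0.
- exact: S1.
- by rewrite -gr_oppE; apply: SN.
- by rewrite -gr_addE; apply: SD.
- by rewrite -gr_mulE; apply: SM.
Qed.

Local Notation xQ := (piJ n d 'X_(0 : 'I_2)).
Local Notation yQ := (piJ n d 'X_(1 : 'I_2)).
Local Notation fQ := (fun t => piJ n d (fib t)).
Local Notation cls := (cls xQ yQ fQ).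

Fixpoint word_class (a : green_word k n d) : Q :=
  match a with
  | Cls U => cls U
  | Gzero => 0
  | Gone => 1
  | Gopp a => - word_class a
  | Gadd a b => word_class a + word_class b
  | Gmul a b => word_class a * word_class b
  end.

Let xQn : xQ ^+ n = 1 := piJ_rel1 n d.
Let fQ0 : fQ 0%N = 0. Proof. exact: rmorph0. Qed.
Let fQ1 : fQ 1%N = 1. Proof. exact: rmorph1. Qed.
Let fQS : forall t, fQ t.+2 = yQ * fQ t.+1 - xQ * fQ t := @piJ_fibS n d.
Let fQd : (yQ - xQ - 1) * fQ d = 0 := piJ_rel2 n d.

Lemma word_class_eq a b : green_eq zetaP qP dP a b -> word_class a = word_class b.
Proof.
elim=> {a b} //=.
- by move=> a b c _ -> _.
- by move=> a b _ ->.
- by move=> a b a' b' _ -> _ ->.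
- by move=> a b a' b' _ -> _ ->.
- by move=> a b c; rewrite addrA.
- by move=> a b; rewrite addrC.
- by move=> a; rewrite add0r.
- by move=> a; rewrite addNr.
- by move=> a b c; rewrite mulrA.
- by move=> a; rewrite mul1r.
- by move=> a; rewrite mulr1.
- by move=> a b c; rewrite mulrDl.
- by move=> a b c; rewrite mulrDr.
- by move=> U W; apply: (cls_iso zetaP).
- by move=> U W; rewrite cls_dsum.
- by move=> U W; rewrite cls_tensor.
(* The relation [V(0,0)] = 1: this comodule is the string of length 1 at vertex 0, with class X ^
   0. *)
- have iso := string_V k n_gt0 d_gt0 (Ordinal n_gt0) (e := Ordinal d_gt0) (string_len1 dP).
  by rewrite -(cls_iso zetaP _ _ _ iso) [LHS](cls_string zetaP dP yQ fQ xQn 0).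
Qed.

Definition green_class (g : G) : Q := word_class (repr g).

Lemma green_class_gr a : green_class (gr a) = word_class a.
Proof. exact/word_class_eq/repr_gr. Qed.

Lemma green_class_zmod : zmod_morphism green_class.
Proof.
elim/gr_ind => a; elim/gr_ind => b.
by rewrite -[- gr b]/(gr_opp _) gr_oppE [gr a + _]gr_addE !green_class_gr.
Qed.

Lemma green_class_monoid : monoid_morphism green_class.
Proof.
split; first exact: (green_class_gr (Gone _ _ _)).
elim/gr_ind => a; elim/gr_ind => b.
by rewrite [gr a * _]gr_mulE !green_class_gr.
Qed.

HB.instance Definition _ :=
  GRing.isZmodMorphism.Build G Q green_class green_class_zmod.
HB.instance Definition _ :=
  GRing.isMonoidMorphism.Build G Q green_class green_class_monoid.

Lemma green_class_bij : bijective green_class.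
Proof.
(* The Green ring is nonzero because it maps to the nonzero ring [Q]. *)
have one_neq0 : (1 : G) != 0.
  apply/eqP => /(congr1 green_class); rewrite rmorph1 rmorph0 => /eqP.
  by rewrite oner_eq0.
pose R : nzRingType := HB.pack G (GRing.PzSemiRing_isNonZero.Build G one_neq0).
pose phi : {rmorphism R -> Q} := green_class.
apply: (@bijective_of_presentation n d R phi (cl gen_x) (cl gen_y) gr_fib).
- exact: gr_gen_comm.
- exact: gr_gen_x_n.
- by [].
- by [].
- by case=> [|t] //=; rewrite mulr1 mulr0 subr0.
- exact: gr_fib_rel.
- by rewrite /phi /= green_class_gr /= cls_gen_x.
- by rewrite /phi /= green_class_gr /= (cls_gen_y zetaP qP).
- exact: green_gen.
Qed.

End Isomorphism.

Theorem theorem4p4 (k : closedFieldType) (k_char0 : [pchar k] =i pred0)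
  (n : nat) (n_gt1 : (1 < n)%N)
  (zeta : k) (zetaP : n.-primitive_root zeta)
  (s : nat) (s_le : (s <= n.-1)%N)
  (q : k) (qP : q ^+ n = zeta ^+ s)
  (d : nat) (dP : d.-primitive_root q) :
  exists phi : {rmorphism green_ring zetaP qP dP -> {ideal_quot J n d}},
    bijective phi.
Proof.
exists (@green_class k n zeta s q d zetaP qP dP).
exact: green_class_bij.
Qed.
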